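(* Let $\alpha\in(0,2]$ and $\beta\in(0,1)$. Let $(\mathsf M,\mathsf d)$ be a metric space with a marked point $o\in\mathsf M$, let $G$ be a group acting on $\mathsf M$, let $(E,\mathcal E,\mu)$ be a $\sigma$-finite measure space, and let $\{A_x\}_{x\in\mathsf M}\subset\mathcal E$ be such that: (i) $\mathsf d(x,y)=\mu(A_x\Delta A_y)$ for all $x,y\in\mathsf M$; (ii) $G$ also acts on $E$ (with $gA\in\mathcal E$ for all $g\in G$, $A\in\mathcal E$), and $A_{g(x)}\Delta A_{g(y)}=g(A_x\Delta A_y)=(gA_x)\Delta(gA_y)$ for all $g\in G$, $x,y\in\mathsf M$; (iii) $\mu$ is $G$-invariant, i.e. $\mu(gA)=\mu(A)$ for all $g\in G$, $A\in\mathcal E$; (iv) $A_o=\emptyset$. Let $\eta_{\alpha,\beta}(x):=Y_{\alpha,\beta}(A_x)$, $x\in\mathsf M$, where $Y_{\alpha,\beta}$ is the set-indexed Karlin stable process associated with $(E,\mathcal E,\mu)$. Then $\{\eta_{\alpha,\beta}(x)\}_{x\in\mathsf M}$ is an S$\alpha$S process with stationary increments with respect to $G$, that is, for every $g\in G$, $$\{\eta_{\alpha,\beta}(g(x))-\eta_{\alpha,\beta}(g(o))\}_{x\in\mathsf M}\overset{d}{=}\{\eta_{\alpha,\beta}(x)\}_{x\in\mathsf M}$$ in the sense of equality of finite-dimensional distributions.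
   Context: Stable laws: $S_\alpha(\sigma,0,0)$ denotes the symmetric $\alpha$-stable (S$\alpha$S) law with characteristic function $\theta\mapsto\exp(-\sigma^\alpha|\theta|^\alpha)$, for $\alpha\in(0,2]$ (including the Gaussian case $\alpha=2$); $\sigma=0$ gives the point mass at $0$. A real-valued process is S$\alpha$S if all finite linear combinations of its values have a law $S_\alpha(\sigma,0,0)$ for some $\sigma\ge 0$. S$\alpha$S random measure: an S$\alpha$S random measure $M$ with control measure $\kappa$ on a measurable space is a family of random variables $M(B)$, indexed by measurable $B$ with $\kappa(B)<\infty$, such that $M(B)\sim S_\alpha(\kappa(B)^{1/\alpha},0,0)$, the values on pairwise disjoint sets are independent, and $M(\bigcup_iB_i)=\sum_iM(B_i)$ almost surely for disjoint $B_i$ whose union has finite $\kappa$-measure. Write $\int\mathbf 1_B\,dM=M(B)$. Point measures: $\mathbb M_p(E)$ is the space of point measures $m=\sum_i\delta_{x_i}$ (countable sums, $x_i\in E$) on $(E,\mathcal E)$, with the $\sigma$-algebra $\mathcal M_p(E)$ generated by the maps $m\mapsto m(A)$, $A\in\mathcal E$. For $r>0$, $\mathbb P'_{r,\mu}$ is the law on $\mathbb M_p(E)$ of the Poisson point process on $(E,\mathcal E)$ with mean measure $r\mu$. For $\beta\in(0,1)$ define the measure on $\mathbb M_p(E)$ $$\mu_\beta(\cdot):=c_\beta\int_0^\infty r^{-\beta-1}\,\mathbb P'_{r,\mu}(\cdot)\,dr,\qquad c_\beta:=\frac{\beta 2^{1-\beta}}{\Gamma(1-\beta)}.$$ Set-indexed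 Karlin stable process: let $\mathcal A=\{A\in\mathcal E:\mu(A)<\infty\}$. With $M_{\alpha,\beta}$ an S$\alpha$S random measure on $\mathbb M_p(E)$ with control measure $\mu_\beta$, set $$Y_{\alpha,\beta}(A):=\int_{\mathbb M_p(E)}\mathbf 1_{\{m(A)\text{ odd}\}}\,M_{\alpha,\beta}(dm),\qquad A\in\mathcal A.$$ (By (i) and (iv), $\mu(A_x)=\mathsf d(x,o)<\infty$, so $A_x\in\mathcal A$.) The laws of all processes are understood through their finite-dimensional distributions. $\Delta$ denotes symmetric difference. *)

(* Defs.v *)
From HB Require Import structures.
From mathcomp Require Import all_boot all_order all_algebra.
From mathcomp Require Import all_classical all_reals all_analysis.
From mathcomp Require Import measurable_realfun.
From mathcomp.real_closed Require Import complex.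

Set Implicit Arguments.
Unset Strict Implicit.
Unset Printing Implicit Defensive.

Import Order.TTheory GRing.Theory Num.Theory.
Import numFieldNormedType.Exports.

Local Open Scope classical_set_scope.
Local Open Scope ring_scope.

Section random_elements.
Context {d} {Omega : measurableType d} {R : realType}.
Variable P : probability Omega R.

(* Mutual independence of a finite family: the product rule for subfamilies is
   the case where some of the [C i] are [setT]. *)
Definition mutually_independent {d'} {T : measurableType d'} (n : nat)
    (X : 'I_n -> Omega -> T) : Prop :=
  forall C : 'I_n -> set T, (forall i, measurable (C i)) ->
    P (\bigcap_(i in [set: 'I_n]) (X i @^-1` C i)) =
    (\prod_(i < n) P (X i @^-1` C i))%E.

(* E[cos (theta X)] + i E[sin (theta X)]. *)
Definition char_fun (X : Omega -> R) (theta : R) : R[i] :=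
  Complex (\int[P]_w cos (theta * X w)) (\int[P]_w sin (theta * X w)).

(* [X] has law S_alpha(sigma, 0, 0). Since 0 `^ alpha = 0 for alpha != 0, the
   value sigma = 0 gives the constant characteristic function 1. *)
Definition has_sas_law (alpha sigma : R) (X : Omega -> R) : Prop :=
  forall theta : R,
    char_fun X theta =
    Complex (expR (- (sigma `^ alpha * `|theta| `^ alpha))) 0.

Definition is_sas_process {I : Type} (alpha : R)
    (X : I -> {mfun Omega >-> R}) : Prop :=
  forall (n : nat) (t : 'I_n -> I) (c : 'I_n -> R),
    exists2 sigma : R, 0 <= sigma &
      has_sas_law alpha sigma (fun w => \sum_(i < n) c i * X (t i) w).

Definition fdd_eq {I : Type} (X Y : I -> Omega -> R) : Prop :=
  forall (n : nat) (t : 'I_n -> I) (B : set (n.-tuple R)), measurable B ->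
    P [set w | B [tuple X (t i) w | i < n]] =
    P [set w | B [tuple Y (t i) w | i < n]].

(* [M B] is meaningful only for measurable [B] with [kappa B < +oo]. *)
Definition is_sas_random_measure {d'} {T : measurableType d'} (alpha : R)
    (kappa : {measure set T -> \bar R})
    (M : set T -> {mfun Omega >-> R}) : Prop :=
  [/\ forall B, measurable B -> (kappa B < +oo)%E ->
        has_sas_law alpha (fine (kappa B) `^ alpha^-1) (M B),
      forall (n : nat) (B : 'I_n -> set T),
        (forall i, measurable (B i)) -> (forall i, (kappa (B i) < +oo)%E) ->
        trivIset [set: 'I_n] B ->
        mutually_independent (fun i => M (B i) : Omega -> R)
    & forall B : nat -> set T,
        (forall i, measurable (B i)) -> trivIset [set: nat] B ->
        (kappa (\bigcup_i B i) < +oo)%E ->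
        {ae P, forall w,
          (fun n => \sum_(0 <= i < n) M (B i) w) @ \oo
            --> M (\bigcup_i B i) w}].

End random_elements.

Section point_measures.
Context {d} (E : measurableType d) (R : realType).

(* A countable sum of Dirac masses; the index set [I] may be finite or empty,
   and [x] need not be injective. Point measures that differ only on
   non-measurable sets are distinct terms, but the sigma-algebra [pm_measurable]
   does not separate them. *)
Definition is_point_measure (m : {measure set E -> \bar R}) : Prop :=
  exists (I : set nat) (x : nat -> E),
    forall A, measurable A -> m A = (\esum_(i in I) \d_(x i) A)%E.

Record point_measure : Type := PointMeasure {
  pm_measure :> {measure set E -> \bar R} ;
  pm_measureP : is_point_measure pm_measure }.

Lemma is_point_measure0 : is_point_measure mzero.
Proof. by exists set0, (fun=> point) => A _; rewrite esum_set0. Qed.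

HB.instance Definition _ := gen_eqMixin point_measure.
HB.instance Definition _ := gen_choiceMixin point_measure.
HB.instance Definition _ :=
  isPointed.Build point_measure (PointMeasure is_point_measure0).

Definition pm_ev (A : set E) (m : point_measure) : \bar R := m A.

Definition pm_measurable : set (set point_measure) :=
  <<s \bigcup_(A in @measurable _ E)
        preimage_set_system [set: point_measure] (pm_ev A)
          (@measurable _ (\bar R)) >>.

Let pm_measurable0 : pm_measurable set0.
Proof. exact: sigma_algebra0. Qed.

Let pm_measurableC (U : set point_measure) :
  pm_measurable U -> pm_measurable (~` U).
Proof. exact: sigma_algebraC. Qed.

Let pm_measurableU (F : (set point_measure)^nat) :
  (forall i, pm_measurable (F i)) -> pm_measurable (\bigcup_i F i).
Proof. exact: sigma_algebra_bigcup. Qed.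

Definition pm_display : measure_display.
Proof. by constructor. Qed.

HB.instance Definition _ := @isMeasurable.Build pm_display point_measure
  pm_measurable pm_measurable0 pm_measurableC pm_measurableU.

(* The law on point measures of the Poisson point process with mean measure
   [nu]. For [nu A = +oo], the Poisson law of parameter +oo is the Dirac mass at
   +oo. The second argument of [poisson_prob] is a dummy. *)
Definition is_poisson_process_law (nu : {measure set E -> \bar R})
    (Q : probability point_measure R) : Prop :=
  [/\ forall A, measurable A -> (nu A < +oo)%E -> forall k : nat,
        Q [set m | m A = k%:R%:E] = poisson_prob (fine (nu A)) 0 [set k],
      forall A, measurable A -> nu A = +oo%E -> Q [set m | m A = +oo%E] = 1%E
    & forall (n : nat) (A : 'I_n -> set E),
        (forall i, measurable (A i)) -> trivIset [set: 'I_n] A ->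
        mutually_independent Q (fun i => pm_ev (A i))].

Definition odd_count (A : set E) : set point_measure :=
  [set m | exists2 k : nat, odd k & m A = k%:R%:E].

End point_measures.

Section karlin.
Context {R : realType}.

Definition Gamma (a : R) : R :=
  \int[@lebesgue_measure R]_(x in `]0, +oo[) (x `^ (a - 1) * expR (- x)).

Definition karlin_cst (beta : R) : R :=
  beta * 2 `^ (1 - beta) / Gamma (1 - beta).

Context {d} {E : measurableType d}.

(* The set function mu_beta, from the laws [PP r] of the Poisson point processes
   with mean measures r * mu; only the values [PP r] for r > 0 are used. *)
Definition karlin_measure (beta : R) (PP : R -> probability (point_measure E R) R)
    (B : set (point_measure E R)) : \bar R :=
  ((karlin_cst beta)%:E *
   \int[@lebesgue_measure R]_(r in `]0%R, +oo[)
     ((r `^ (- beta - 1))%:E * PP r B))%E.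

(* [M (odd_count A)] is the integral of the indicator of {m | m(A) odd}; it is
   used for measurable [A] with [mu A < +oo]. *)
Definition karlin_process {d'} {Omega : measurableType d'}
    (M : set (point_measure E R) -> {mfun Omega >-> R}) (A : set E) :
    {mfun Omega >-> R} :=
  M (odd_count (R := R) A).

End karlin.

Definition is_group_action {G : groupType} {T : Type} (act : G -> T -> T) :
    Prop :=
  (forall x, act 1%g x = x) /\
  (forall g h x, act (g * h)%g x = act g (act h x)).

(* Main.v *)
Require Import Defs.
From mathcomp Require Import all_boot all_order all_algebra.
From mathcomp Require Import finmap.
From mathcomp Require Import all_classical all_reals all_analysis.
From mathcomp Require Import measurable_realfun.
From mathcomp.real_closed Require Import complex.
From mathcomp Require Import ring lra.

Set Implicit Arguments.
Unset Strict Implicit.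
Unset Printing Implicit Defensive.

Import Order.TTheory GRing.Theory Num.Theory.
Import numFieldNormedType.Exports.

Local Open Scope classical_set_scope.
Local Open Scope ring_scope.

(* A linear combination sum_i a_i M(B_i) of values of the random measure is,
   after splitting the B_i into atoms, a combination of independent symmetric
   stable variables, so it is symmetric stable with scale
   (int |sum_i a_i 1_(B_i)|^alpha dkappa)^(1/alpha). By uniqueness of joint
   characteristic functions it remains to compare these integrals for the
   increments and for the process. Write O(A) for {m | m(A) odd}. Pointwise
   |sum_i c_i (1_U_i - 1_V)| = |sum_i c_i 1_(U_i + V)| (symmetric difference),
   and up to a null set O(A_(gx)) + O(A_(go)) = O(A_(gx) + A_(go)) = O(g A_x).
   Finally |sum_i c_i 1_(O(A_i))|^alpha is, by Fourier inversion on the cube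
   {0,1}^n, a linear combination of indicators of symmetric differences of the
   O(A_i), that is of O(C) for C a symmetric difference of the A_i, and
   mu_beta(O(C)) depends only on mu(C), which is invariant under g. *)

(** * Uniqueness of the joint characteristic function *)

(** Parity drives the comparison: it turns symmetric differences into sums modulo 2, so [O] commutes
    with symmetric differences wherever all counts are finite; point measures with an infinite count
    form the exceptional null set. No point process is transported by g. The random measure is seen
    only through sets of odd counts, and [mu_beta] of O(C) integrates over r the probability that a
    Poisson variable of rate r mu(C) is odd, a function of mu(C) alone. The inversion on the cube
    needs no constant term because a linear combination of indicators vanishes where all of them do.
    Two analytic points remain. The values M(O(C)) are controlled only if O(C) has finite mass: the
    parity probability is at most min(1, r mu(C)), which compensates r^(-beta-1) at 0 since beta <
    1, while the bound 1 suffices at infinity since beta > 0. For the uniqueness theorem only means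
    of trigonometric functions are known; indicators are reached from them by products and bounded
    limits, a polynomial iteration with values in [0, 1] taking the place of an inversion
    formula. *)

Section bounded_measurable.
Context {d} {T : measurableType d} {R : realType}.
Implicit Types f g : T -> R.

Definition bounded_measurable f :=
  measurable_fun [set: T] f /\ exists K, forall x, `|f x| <= K.

Lemma bounded_measurable_cst (r : R) : bounded_measurable (fun=> r).
Proof. by split => //; exists `|r|. Qed.

Lemma bounded_measurableD f g : bounded_measurable f -> bounded_measurable g ->
  bounded_measurable (fun x => f x + g x).
Proof.
move=> [mf [K fK]] [mg [L gL]]; split; first exact: measurable_funD.
by exists (K + L) => x; rewrite (le_trans (ler_normD _ _))// lerD.
Qed.

Lemma bounded_measurableM f g : bounded_measurable f -> bounded_measurable g ->
  bounded_measurable (fun x => f x * g x).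
Proof.
move=> [mf [K fK]] [mg [L gL]]; split; first exact: measurable_funM.
by exists (K * L) => x; rewrite normrM ler_pM.
Qed.

Lemma bounded_measurable_indic (A : set T) : measurable A ->
  bounded_measurable (\1_A : T -> R).
Proof.
move=> mA; split; first exact: measurable_indic.
by exists 1 => x; rewrite indicE ger0_norm ?ler0n// lern1 leq_b1.
Qed.

Lemma bounded_measurable_cos f : measurable_fun [set: T] f ->
  bounded_measurable (fun x => cos (f x)).
Proof.
move=> mf; split.
  exact: measurableT_comp (continuous_measurable_fun (@continuous_cos R)) mf.
by exists 1 => x; rewrite ler_norml cos_geN1 cos_le1.
Qed.

Lemma bounded_measurable_sin f : measurable_fun [set: T] f ->
  bounded_measurable (fun x => sin (f x)).
Proof.
move=> mf; split.
  exact: measurableT_comp (continuous_measurable_fun (@continuous_sin R)) mf.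
by exists 1 => x; rewrite ler_norml sin_geN1 sin_le1.
Qed.

End bounded_measurable.

Lemma bounded_measurable_comp {d d'} {U : measurableType d} {T : measurableType d'}
    {R : realType} (X : U -> T) (f : T -> R) :
  measurable_fun [set: U] X -> bounded_measurable f ->
  bounded_measurable (fun w => f (X w)).
Proof.
move=> mX [mf [K fK]]; split; first exact: measurableT_comp.
by exists K.
Qed.

Section bounded_convergence.
Context {d} {T : measurableType d} {R : realType}.
Implicit Types f g : T -> R.
Variable P : probability T R.

Lemma bounded_measurable_integrable f : bounded_measurable f ->
  P.-integrable [set: T] (EFin \o f).
Proof.
move=> [mf [K fK]]; apply: measurable_bounded_integrable => //.
  exact: le_lt_trans (probability_le1 P measurableT) (ltry 1).
exists K; split; first exact: num_real.
by move=> x Kx t _ /=; apply: le_trans (ltW Kx); exact: fK.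
Qed.

Lemma bounded_measurable_cvg (f_ : nat -> T -> R) f (K : R) :
  (forall n, measurable_fun [set: T] (f_ n)) ->
  (forall n x, `|f_ n x| <= K) ->
  (forall x, f_ ^~ x @ \oo --> f x) -> bounded_measurable f.
Proof.
move=> mf_ f_K f_f; split.
  by apply: (measurable_fun_cvg mf_) => x _; exact: f_f.
exists K => x.
rewrite -(cvg_lim (@Rhausdorff R) (cvg_norm (f_f x))); apply: limr_le.
  exact: cvgP (cvg_norm (f_f x)).
by apply: nearW.
Qed.

Lemma bounded_convergence (f_ : nat -> T -> R) f (K : R) :
  (forall n, measurable_fun [set: T] (f_ n)) ->
  (forall n x, `|f_ n x| <= K) ->
  (forall x, f_ ^~ x @ \oo --> f x) ->
  bounded_measurable f /\ \int[P]_x f_ n x @[n --> \oo] --> \int[P]_x f x.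
Proof.
move=> mf_ f_K f_f.
have bf := bounded_measurable_cvg mf_ f_K f_f.
split=> //.
apply: fine_cvg; rewrite fineK; last first.
  by apply: integrable_fin_num => //; exact: bounded_measurable_integrable.
have mf := bf.1.
have [|||||_ _] := @dominated_convergence _ _ _ P _ measurableT
  (fun n => EFin \o f_ n) (EFin \o f) (EFin \o cst K); last exact.
- by move=> n; exact/measurable_EFinP.
- exact/measurable_EFinP.
- by apply: aeW => x _; apply: cvg_EFin; [exact: nearW|exact: f_f].
- exact: finite_measure_integrable_cst.
- by apply: aeW => x n _; rewrite lee_fin.
Qed.

Lemma Rintegral_probability_cst (r : R) : \int[P]_x r = r.
Proof. by rewrite Rintegral_cst//= (@probability_setT _ _ _ P)/= mulr1. Qed.

End bounded_convergence.

(** * A polynomial iteration converging to a step function *)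

Section smoothstep.
Context {R : realType}.
Implicit Types y : R.

(* Iterating this polynomial on [0, 1] pushes values away from 1/2 to 0 or 1, so
   [smoothstep_limit] composed with a multiplier is again a multiplier. *)
Definition smoothstep y : R := y * y * (3 - 2 * y).

(** The graph is symmetric about the point (1/2, 1/2), so the behaviour above 1/2 is read off from
    the one below. *)
Lemma smoothstepC y : smoothstep (1 - y) = 1 - smoothstep y.
Proof. by rewrite /smoothstep; ring. Qed.

Lemma iter_smoothstepC k y :
  iter k smoothstep (1 - y) = 1 - iter k smoothstep y.
Proof. by elim: k => //= k ->; rewrite smoothstepC. Qed.

Lemma smoothstep01 y : 0 <= y <= 1 -> 0 <= smoothstep y <= 1.
Proof.
have ge0 z : 0 <= z -> z <= 1 -> 0 <= smoothstep z.
  by move=> z0 z1; rewrite /smoothstep !mulr_ge0//; lra.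
move=> /andP[y0 y1]; rewrite ge0//= -subr_ge0 -smoothstepC.
by apply: ge0; lra.
Qed.

Lemma iter_smoothstep01 k y : 0 <= y <= 1 -> 0 <= iter k smoothstep y <= 1.
Proof. by move=> y01; elim: k => //= k /smoothstep01. Qed.

Lemma iter_smoothstep_half k : iter k smoothstep 2^-1 = 2^-1 :> R.
Proof. by elim: k => //= k ->; rewrite /smoothstep; field. Qed.

(** The factor z (3 - 2 z) relating z to its image is increasing on [0, 1/2] and equals 1 only at
    1/2. Iterates stay below [y], so each step contracts at least by the value [q] of this factor at
    [y]. *)
Lemma cvg_iter_smoothstep0 y : 0 <= y < 2^-1 ->
  iter k smoothstep y @[k --> \oo] --> 0.
Proof.
move=> /andP[y0 y2].
pose q := y * (3 - 2 * y).
have q0 : 0 <= q by rewrite /q mulr_ge0//; lra.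
have q1 : q < 1.
  by rewrite -subr_gt0 (_ : 1 - q = (1 - y) * (1 - 2 * y)) ?mulr_gt0 ?/q//; [lra|lra|ring].
have H k : 0 <= iter k smoothstep y <= y * q ^+ k.
  elim: k => [|k /andP[i0 ik]]; first by rewrite expr0 mulr1 y0/=.
  rewrite iterS; set z := iter k smoothstep y in i0 ik *.
  have qk : q ^+ k <= 1 by rewrite exprn_ile1// ltW.
  have zy : z <= y by rewrite (le_trans ik)// ler_piMr.
  apply/andP; split; first by rewrite /smoothstep !mulr_ge0//; lra.
  rewrite exprSr mulrA (@le_trans _ _ (z * q))//; last by rewrite ler_wpM2r.
  rewrite /smoothstep -mulrA ler_wpM2l// -subr_ge0.
  rewrite (_ : q - _ = (y - z) * (3 - 2 * (y + z))); last by rewrite /q; ring.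
  by rewrite mulr_ge0//; lra.
apply: (@squeeze_cvgr _ _ _ _ (fun=> 0) (fun k => y * q ^+ k)).
- by apply: nearW => k; exact: H.
- exact: cvg_cst.
- rewrite -[X in _ --> X](mulr0 y); apply: cvgMr; apply: cvg_expr.
  by rewrite ger0_norm.
Qed.

Definition smoothstep_limit y : R :=
  if y < 2^-1 then 0 else if y == 2^-1 then 2^-1 else 1.

Lemma cvg_iter_smoothstep y : 0 <= y <= 1 ->
  iter k smoothstep y @[k --> \oo] --> smoothstep_limit y.
Proof.
move=> /andP[y0 y1]; rewrite /smoothstep_limit; case: ltgtP => [y2|y2|->].
- by apply: cvg_iter_smoothstep0; rewrite y0.
- rewrite -[X in _ --> X]subr0.
  rewrite (_ : (fun _ => _) = fun k => 1 - iter k smoothstep (1 - y)).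
    apply: cvgB; first exact: cvg_cst.
    by apply: cvg_iter_smoothstep0; apply/andP; split; lra.
  by apply/funext => k; rewrite iter_smoothstepC subKr.
- under eq_fun do rewrite iter_smoothstep_half.
  exact: cvg_cst.
Qed.

End smoothstep.

(** * From trigonometric means to probabilities of measurable sets *)

Section characteristic_function_uniqueness.
Context {d} {Omega : measurableType d} {R : realType}.
Variables (P : probability Omega R) (n : nat) (X Y : Omega -> n.-tuple R).
Hypotheses (mX : measurable_fun [set: Omega] X).
Hypotheses (mY : measurable_fun [set: Omega] Y).
Implicit Types f g : n.-tuple R -> R.

Let phase (c : 'I_n -> R) (x : n.-tuple R) : R := \sum_(i < n) c i * tnth x i.

Hypothesis cosXY : forall c, \int[P]_w cos (phase c (X w)) =
                             \int[P]_w cos (phase c (Y w)).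
Hypothesis sinXY : forall c, \int[P]_w sin (phase c (X w)) =
                             \int[P]_w sin (phase c (Y w)).

Let same_mean f := \int[P]_w f (X w) = \int[P]_w f (Y w).

(* The phase shift [a] covers cosines and sines at once. *)
Definition trig_test f := bounded_measurable f /\
  forall c a, same_mean (fun x => f x * cos (phase c x + a)).

(* The multipliers form an algebra closed under bounded pointwise limits and
   containing the trigonometric functions; hence the sets whose indicator is a
   multiplier form a sigma-algebra, which is shown to contain the half-spaces
   [a < x_i]. *)
Definition trig_multiplier g := bounded_measurable g /\
  forall f, trig_test f -> trig_test (fun x => f x * g x).

Let bm_cos c a : bounded_measurable (fun x => cos (phase c x + a)).
Proof.
apply: bounded_measurable_cos; apply: measurable_funD => //.
apply: measurable_sum => i; apply: measurable_funM => //.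
exact: measurable_tnth.
Qed.

Let same_meanD f g : bounded_measurable f -> bounded_measurable g ->
  same_mean f -> same_mean g -> same_mean (fun x => f x + g x).
Proof.
move=> bf bg ef eg; rewrite /same_mean !RintegralD//; first by rewrite ef eg.
all: apply: bounded_measurable_integrable.
- exact: bounded_measurable_comp mY bf.
- exact: bounded_measurable_comp mY bg.
- exact: bounded_measurable_comp mX bf.
- exact: bounded_measurable_comp mX bg.
Qed.

Let same_meanZ r f : bounded_measurable f ->
  same_mean f -> same_mean (fun x => r * f x).
Proof.
move=> bf ef; rewrite /same_mean !RintegralZl//; first by rewrite ef.
all: apply: bounded_measurable_integrable.
- exact: bounded_measurable_comp mY bf.
- exact: bounded_measurable_comp mX bf.
Qed.

Let same_mean_cvg (f_ : nat -> n.-tuple R -> R) f (K : R) :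
  (forall k, measurable_fun [set: n.-tuple R] (f_ k)) ->
  (forall k x, `|f_ k x| <= K) -> (forall x, f_ ^~ x @ \oo --> f x) ->
  (forall k, same_mean (f_ k)) -> same_mean f.
Proof.
move=> mf_ f_K f_f ef.
have [_ cX] := bounded_convergence P (f_ := fun k w => f_ k (X w))
  (fun k => measurableT_comp (mf_ k) mX) (fun k w => f_K k (X w))
  (fun w => f_f (X w)).
have [_ cY] := bounded_convergence P (f_ := fun k w => f_ k (Y w))
  (fun k => measurableT_comp (mf_ k) mY) (fun k w => f_K k (Y w))
  (fun w => f_f (Y w)).
have eXY : (fun k => \int[P]_w f_ k (X w)) = (fun k => \int[P]_w f_ k (Y w)).
  by apply/funext => k; exact: ef.
by rewrite eXY in cX; rewrite /same_mean; exact: (cvg_unique _ cX cY).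
Qed.

Let eq_same_mean f g : f =1 g -> same_mean f -> same_mean g.
Proof. by move=> /funext ->. Qed.

Let trig_testD f g : trig_test f -> trig_test g -> trig_test (fun x => f x + g x).
Proof.
move=> [bf ef] [bg eg]; split; first exact: bounded_measurableD.
move=> c a; apply: (eq_same_mean (f := fun x =>
  f x * cos (phase c x + a) + g x * cos (phase c x + a))).
  by move=> x; rewrite mulrDl.
by apply: same_meanD => //; exact: bounded_measurableM.
Qed.

Let trig_testZ r f : trig_test f -> trig_test (fun x => r * f x).
Proof.
move=> [bf ef]; split.
  by apply: bounded_measurableM => //; exact: bounded_measurable_cst.
move=> c a; apply: (eq_same_mean (f := fun x =>
  r * (f x * cos (phase c x + a)))).
  by move=> x; rewrite mulrA.
by apply: same_meanZ => //; exact: bounded_measurableM.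
Qed.

Let trig_test_cvg (f_ : nat -> n.-tuple R -> R) f (K : R) :
  (forall k x, `|f_ k x| <= K) -> (forall x, f_ ^~ x @ \oo --> f x) ->
  (forall k, trig_test (f_ k)) -> trig_test f.
Proof.
move=> f_K f_f tf.
have mf_ k : measurable_fun [set: n.-tuple R] (f_ k) by have [[]] := tf k.
split; first exact: bounded_measurable_cvg f_K f_f.
move=> c a.
apply: (@same_mean_cvg (fun k x => f_ k x * cos (phase c x + a)) _ K).
- by move=> k; apply: measurable_funM => //; have [] := bm_cos c a.
- move=> k x; rewrite normrM -[K]mulr1 ler_pM//.
  by rewrite ler_norml cos_geN1 cos_le1.
- by move=> x; apply: cvgMl; exact: f_f.
- by move=> k; have [_] := tf k.
Qed.

(** The only entry point of the equality of characteristic functions; the addition formula for the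
    cosine removes the phase shift. *)
Let trig_test1 : trig_test (fun=> 1).
Proof.
split; first exact: bounded_measurable_cst.
have b0 c : measurable_fun [set: n.-tuple R] (phase c).
  apply: measurable_sum => i; apply: measurable_funM => //.
  exact: measurable_tnth.
move=> c a; apply: (eq_same_mean (f := fun x =>
  cos a * cos (phase c x) + (- sin a) * sin (phase c x))).
  by move=> x; rewrite mul1r cosD; ring.
apply: same_meanD.
- apply: bounded_measurableM; first exact: bounded_measurable_cst.
  exact: bounded_measurable_cos.
- apply: bounded_measurableM; first exact: bounded_measurable_cst.
  exact: bounded_measurable_sin.
- by apply: same_meanZ; [exact: bounded_measurable_cos|exact: cosXY].
- by apply: same_meanZ; [exact: bounded_measurable_sin|exact: sinXY].
Qed.

Let eq_trig_test f g : f =1 g -> trig_test f -> trig_test g.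
Proof. by move=> /funext ->. Qed.

Let multiplier_cst r : trig_multiplier (fun=> r).
Proof.
split; first exact: bounded_measurable_cst.
by move=> f /(trig_testZ r); apply: eq_trig_test => x; rewrite mulrC.
Qed.

Let multiplierD f g : trig_multiplier f -> trig_multiplier g ->
  trig_multiplier (fun x => f x + g x).
Proof.
move=> [bf tf] [bg tg]; split; first exact: bounded_measurableD.
move=> h th; have := trig_testD (tf _ th) (tg _ th).
by apply: eq_trig_test => x; rewrite mulrDr.
Qed.

Let multiplierM f g : trig_multiplier f -> trig_multiplier g ->
  trig_multiplier (fun x => f x * g x).
Proof.
move=> [bf tf] [bg tg]; split; first exact: bounded_measurableM.
move=> h th; have := tg _ (tf _ th).
by apply: eq_trig_test => x; rewrite mulrA.
Qed.

Let multiplier_cvg (f_ : nat -> n.-tuple R -> R) f (K : R) :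
  (forall k x, `|f_ k x| <= K) -> (forall x, f_ ^~ x @ \oo --> f x) ->
  (forall k, trig_multiplier (f_ k)) -> trig_multiplier f.
Proof.
move=> f_K f_f tf; split.
  by apply: bounded_measurable_cvg f_K f_f => k; have [[]] := tf k.
move=> h th; have [[mh [L hL]] _] := th.
apply: (@trig_test_cvg (fun k x => h x * f_ k x) _ (L * K)).
- by move=> k x; rewrite normrM ler_pM.
- by move=> x; apply: cvgMr; exact: f_f.
- by move=> k; have [_] := tf k; exact.
Qed.

(** The product-to-sum formula yields cosines with frequencies [b + c] and [b - c], and a test
    function is tested against all frequencies and phases. *)
Let multiplier_cos b t : trig_multiplier (fun x => cos (phase b x + t)).
Proof.
split; first exact: bm_cos.
move=> f [bf tf]; split; first exact: bounded_measurableM.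
move=> c a.
apply: (eq_same_mean (f := fun x =>
  2^-1 * (f x * cos (phase (fun i => b i + c i) x + (t + a)) +
          f x * cos (phase (fun i => b i - c i) x + (t - a))))).
  move=> x.
  have -> : phase (fun i => b i + c i) x + (t + a) =
      (phase b x + t) + (phase c x + a).
    rewrite {1}/phase; under eq_bigr do rewrite mulrDl.
    by rewrite big_split/= addrACA.
  have -> : phase (fun i => b i - c i) x + (t - a) =
      (phase b x + t) - (phase c x + a).
    rewrite {1}/phase; under eq_bigr do rewrite mulrBl.
    by rewrite sumrB/= opprD addrACA.
  by rewrite cosB cosD; field.
apply: same_meanZ.
  by apply: bounded_measurableD; exact: bounded_measurableM.
by apply: same_meanD => //; exact: bounded_measurableM.
Qed.

Let multiplier_smoothstep k g : trig_multiplier g ->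
  trig_multiplier (fun x => iter k smoothstep (g x)).
Proof.
move=> tg; elim: k => // k IH.
apply: multiplierM; first exact: multiplierM.
apply: multiplierD; first exact: multiplier_cst.
rewrite (_ : (fun _ => _) = fun x => (- 2) * iter k smoothstep (g x)).
  by apply: multiplierM => //; exact: multiplier_cst.
by apply/funext => x; rewrite mulNr.
Qed.

Let multiplier_gt_half g : trig_multiplier g -> (forall x, 0 <= g x <= 1) ->
  trig_multiplier (\1_[set x | 2^-1 < g x]).
Proof.
move=> tg g01.
have tl := multiplier_cvg (K := 1) _ (fun x => cvg_iter_smoothstep (g01 x))
  (fun k => multiplier_smoothstep k tg).
set l := (X in trig_multiplier X) in tl.
have {}tl : trig_multiplier l.
  apply: tl => k x.
  by have /andP[h0 h1] := iter_smoothstep01 k (g01 x); rewrite ger0_norm.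
(* [u (2 u - 1)] sends the limit values 0, 1/2, 1 to 0, 0, 1. *)
rewrite (_ : \1__ = fun x => l x * (2 * l x + (- 1))).
  apply: multiplierM => //; apply: multiplierD; last exact: multiplier_cst.
  by apply: multiplierM => //; exact: multiplier_cst.
apply/funext => x; rewrite /l /smoothstep_limit indicE; case: ltgtP => h.
- by rewrite memNset ?mul0r//= => h'; have := lt_trans h h'; rewrite ltxx.
- by rewrite mem_set//= mul1r; lra.
- by rewrite memNset/= ?h ?ltxx//; field.
Qed.

Let multiplier_ray i (a : R) : trig_multiplier (\1_[set x | a < tnth x i]).
Proof.
(* For large [k] the sign of [sin (z / k)] is that of [z]. *)
pose A_ (k : nat) := [set x : n.-tuple R | 0 < sin (k.+1%:R^-1 * (tnth x i - a))].
apply: (@multiplier_cvg (fun k => \1_(A_ k)) _ 1).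
- by move=> k x; rewrite indicE ger0_norm ?ler0n// lern1 leq_b1.
- move=> x; have [m hm] : exists m : nat, `|tnth x i - a| < m%:R.
    by exists (Num.truncn `|tnth x i - a|).+1; exact: truncnS_gt.
  apply: cvg_near_cst; exists m => // k /= mk; rewrite !indicE; congr ((nat_of_bool _)%:R).
  have hk : `|tnth x i - a| < k.+1%:R.
    by rewrite (lt_le_trans hm)// ler_nat ltnW.
  have pos z : 0 < z -> `|z| < k.+1%:R -> 0 < sin (k.+1%:R^-1 * z).
    move=> z0; rewrite gtr0_norm// => zk; apply: sin2_gt0.
    rewrite mulr_gt0 ?invr_gt0//= mulrC ltr_pdivrMr//.
    by rewrite (lt_trans zk)// ltr_pMl// ltr1n.
  apply/idP/idP; rewrite !inE /A_ /=; last by rewrite -subr_gt0 => /pos; exact.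
  apply: contraPP => /negP; rewrite -leNgt le_eqVlt => /predU1P[->|xa].
    by rewrite subrr mulr0 sin0 ltxx.
  apply/negP; rewrite -leNgt -oppr_ge0 -sinN -mulrN opprB ltW//.
  by apply: pos; rewrite ?subr_gt0// distrC.
- move=> k; pose b := fun j => if j == i then k.+1%:R^-1 else 0 : R.
  have pb x : phase b x = k.+1%:R^-1 * tnth x i.
    rewrite /phase (bigD1 i)//= big1; last first.
      by move=> j /negbTE ji; rewrite /b ji mul0r.
    by rewrite addr0 /b eqxx.
  (* Shifting the phase by pi / 2 makes this (1 + sin u) / 2 with u = (x_i - a) / (k + 1): it lies
     in [0, 1] and exceeds 1/2 exactly when the sine is positive. *)
  have tg := multiplierD (multiplier_cst 2^-1)
    (multiplierM (multiplier_cst 2^-1)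
      (multiplier_cos b (- (k.+1%:R^-1 * a) - pi / 2))).
  rewrite (_ : A_ k = [set x |
      2^-1 < 2^-1 + 2^-1 * cos (phase b x + (- (k.+1%:R^-1 * a) - pi / 2))]).
    apply: multiplier_gt_half tg _ => x.
    set c := cos _; have := cos_geN1 (phase b x + (- (k.+1%:R^-1 * a) - pi / 2)).
    have := cos_le1 (phase b x + (- (k.+1%:R^-1 * a) - pi / 2)).
    by rewrite -/c => h1 h2; apply/andP; split; lra.
  by apply/seteqP; split => x /=; rewrite /A_ /= pb addrA cosBpihalf -mulrBr; lra.
Qed.

Let multiplier_set : set (set (n.-tuple R)) :=
  [set B | trig_multiplier (\1_B)].

Let sigma_algebra_multiplier : sigma_algebra [set: n.-tuple R] multiplier_set.
Proof.
have SC B : multiplier_set B -> multiplier_set (~` B).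
  rewrite /multiplier_set/= => tB.
  rewrite (_ : \1_(~` B) = fun x => 1 + (- 1) * \1_B x).
    apply: multiplierD; first exact: multiplier_cst.
    by apply: multiplierM => //; exact: multiplier_cst.
  by apply/funext => x; rewrite !indicE in_setC; case: (x \in B) => /=; ring.
have S0 : multiplier_set set0 by rewrite /multiplier_set/= indic0; exact: multiplier_cst.
have SU A B : multiplier_set A -> multiplier_set B -> multiplier_set (A `|` B).
  move=> /SC tA /SC tB; rewrite -[A `|` B]setCK setCU; apply: SC.
  by rewrite /multiplier_set/= indicI; exact: multiplierM.
split => //; first by move=> B; rewrite setTD; exact: SC.
move=> F tF; rewrite /multiplier_set/=.
apply: (@multiplier_cvg (fun k => \1_(\bigcup_(j in `I_k) F j)) _ 1).
- by move=> k x; rewrite indicE ger0_norm ?ler0n// lern1 leq_b1.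
- move=> x; have [[j _ Fjx]|nFx] := pselect ((\bigcup_k F k) x).
    apply: cvg_near_cst; exists j.+1 => // k /= jk; rewrite !indicE !mem_set//.
      by exists j.
    by exists j.
  apply: cvg_near_cst; apply: nearW => k; rewrite !indicE !memNset//.
  by move=> [j _ Fjx]; apply: nFx; exists j.
- elim=> [|k IH]; first by rewrite II0 bigcup_set0.
  rewrite IIS bigcup_setU bigcup_set1; exact: SU IH (tF k).
Qed.

Let multiplier_measurable (B : set (n.-tuple R)) : measurable B -> multiplier_set B.
Proof.
have [S0 SC SU] := sigma_algebra_multiplier.
(* The sigma-algebra on tuples is generated by the coordinate preimages of Borel sets, and Borel
   sets are generated by the rays ]a, +oo[. *)
apply: smallest_sub => // C; rewrite -bigcup_seq/= => -[i _ [D mD <-]].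
rewrite setTI.
have : <<s @RGenOInfty.G R >> D.
  have /(congr1 (fun S => S D)) := RGenOInfty.measurableE R.
  by move=> /= e; change ((@RGenOInfty.G R).-sigma.-measurable D); rewrite -e; exact: mD.
move: D {mD}; apply: smallest_sub.
  split.
  - by rewrite /= preimage_set0.
  - by move=> D /= SD; rewrite setTD preimage_setC -setTD; exact: SC.
  - by move=> F SF /=; rewrite preimage_bigcup; exact: SU.
move=> D [a ->] /=; rewrite (_ : _ @^-1` _ = [set x | a < tnth x i]).
  exact: multiplier_ray.
by apply/seteqP; split => x /=; rewrite in_itv/= andbT.
Qed.

Theorem characteristic_function_unique (B : set (n.-tuple R)) : measurable B ->
  P [set w | B (X w)] = P [set w | B (Y w)].
Proof.
move=> mB.
(* The multiplier 1_B is applied to the test function 1 and evaluated at frequency 0 and phase 0,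
   where the cosine is 1. *)
have [_ /(_ _ trig_test1)[_ /(_ (fun=> 0) 0)]] := multiplier_measurable mB.
have phase0 x : phase (fun=> 0) x = 0.
  by rewrite /phase big1// => i _; rewrite mul0r.
rewrite /same_mean.
have E (Z : Omega -> n.-tuple R) : measurable_fun [set: Omega] Z ->
    \int[P]_w (1 * \1_B (Z w) * cos (phase (fun=> 0) (Z w) + 0)) =
    fine (P [set w | B (Z w)]).
  move=> mZ; have mBZ : measurable [set w | B (Z w)].
    by rewrite -[X in measurable X]setTI; exact: mZ.
  under eq_Rintegral do rewrite phase0 addr0 cos0 mul1r mulr1.
  rewrite -(setIT [set w | B (Z w)]) -(integral_indic P measurableT mBZ).
  by congr fine; apply: eq_integral.
rewrite !E// => e.
have mB_ (Z : Omega -> n.-tuple R) : measurable_fun [set: Omega] Z ->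
    measurable [set w | B (Z w)].
  by move=> mZ; rewrite -[X in measurable X]setTI; exact: mZ.
rewrite -[LHS]fineK ?fin_num_measure//; last exact: mB_.
by rewrite -[RHS]fineK ?fin_num_measure//; [rewrite e|exact: mB_].
Qed.

End characteristic_function_uniqueness.

(** * Characteristic functions of sums of independent variables *)

Section bounded_measurable_induction.
Context {d} {T : measurableType d} {R : realType}.
Variable H : (T -> R) -> Prop.
Hypothesis H_indic : forall A, measurable A -> H (\1_A).
Hypothesis HD : forall f g, bounded_measurable f -> bounded_measurable g ->
  H f -> H g -> H (fun x => f x + g x).
Hypothesis HZ : forall r f, bounded_measurable f -> H f -> H (fun x => r * f x).
Hypothesis H_cvg : forall (f_ : nat -> T -> R) (f : T -> R) (K : R),
  (forall k, bounded_measurable (f_ k)) -> (forall k x, `|f_ k x| <= K) ->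
  (forall x, f_ ^~ x @ \oo --> f x) -> (forall k, H (f_ k)) -> H f.

Import HBNNSimple.

Let H_nnsfun (s : {nnsfun T >-> R}) : bounded_measurable s /\ H s.
Proof.
suff step (r : seq R) : let g x := \sum_(y <- r) y * \1_(s @^-1` [set y]) x in
    bounded_measurable g /\ H g.
  have -> : (s : T -> R) = fun x =>
      \sum_(y <- fset_set (range s)) y * \1_(s @^-1` [set y]) x.
    by apply/funext => x; rewrite {1}fimfunE fsbig_finite//=; exact: fimfunP.
  exact: step.
elim: r => [|y r [br Hr]] /=.
  under eq_fun do rewrite big_nil.
  have -> : (fun=> 0) = \1_set0 :> (T -> R) by rewrite indic0.
  by split; [exact: bounded_measurable_indic|exact: H_indic].
under eq_fun do rewrite big_cons.
have mA : measurable (s @^-1` [set y]) by exact: measurable_sfunP.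
have b1 : bounded_measurable (fun x => y * \1_(s @^-1` [set y]) x).
  apply: bounded_measurableM; first exact: bounded_measurable_cst.
  exact: bounded_measurable_indic.
split; first exact: bounded_measurableD.
apply: HD => //; apply: HZ; first exact: bounded_measurable_indic.
exact: H_indic.
Qed.

(** Simple functions increase to a nonnegative measurable function. Adding the bound [K] makes [f]
    nonnegative, and the shift is undone with the indicator of the whole space. *)
Lemma bounded_measurable_ind f : bounded_measurable f -> H f.
Proof.
move=> bf; have [mf [K fK]] := bf.
have bg : bounded_measurable (fun x => f x + K).
  by apply: bounded_measurableD => //; exact: bounded_measurable_cst.
have g0 x : (0 <= (f x + K)%:E)%E.
  by rewrite lee_fin -lerBlDr sub0r; have := fK x; rewrite ler_norml => /andP[].
have mg : measurable_fun [set: T] (EFin \o (fun x => f x + K)).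
  by apply/measurable_EFinP; case: bg.
pose s := nnsfun_approx measurableT mg.
have s_cvg x : s ^~ x @ \oo --> f x + K.
  apply: (fine_cvg (f := fun n => (s n x)%:E)).
  exact: (cvg_nnsfun_approx measurableT mg (fun x _ => g0 x)).
have s_le n x : s n x <= f x + K.
  rewrite -(cvg_lim (@Rhausdorff R) (s_cvg x)).
  apply: nondecreasing_cvgn_le; last exact: cvgP (s_cvg x).
  by move=> a b ab; have /lefP := nd_nnsfun_approx measurableT mg ab; exact.
have Hg : H (fun x => f x + K).
  apply: (@H_cvg (fun n => s n) _ (K + K)) => //.
  - by move=> k; have [] := H_nnsfun (s k).
  - move=> k x; rewrite ger0_norm; last exact: fun_ge0.
    rewrite (le_trans (s_le k x))// lerD2r.
    by have := fK x; rewrite ler_norml => /andP[].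
  - by move=> k; have [] := H_nnsfun (s k).
rewrite (_ : f = fun x => (f x + K) + (- K) * \1_[set: T] x).
  have b1 := bounded_measurable_indic (R := R) (@measurableT _ T).
  apply: HD => //.
    by apply: bounded_measurableM => //; exact: bounded_measurable_cst.
  by apply: HZ => //; exact: H_indic.
by apply/funext => x; rewrite indicE in_setT mulr1 addrK.
Qed.

End bounded_measurable_induction.

Section independence.
Context {d} {Omega : measurableType d} {R : realType}.
Variable P : probability Omega R.

(** Both sides are linear in [f] and continuous under bounded limits. The constant [c] is left free,
    not fixed as the mean of [h], because in the application it is already known: a product of
    earlier factors, or 0. *)
Lemma mean_mul_of_indicators {d'} {T : measurableType d'} (X : Omega -> T)
    (h : Omega -> R) (c : R) : measurable_fun [set: Omega] X ->
  bounded_measurable h ->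
  (forall C, measurable C ->
    \int[P]_w (h w * \1_C (X w)) = c * \int[P]_w (\1_C (X w) : R)) ->
  forall f : T -> R, bounded_measurable f ->
    \int[P]_w (h w * f (X w)) = c * \int[P]_w f (X w).
Proof.
move=> mX bh hC f bf.
have bX (g : T -> R) : bounded_measurable g -> bounded_measurable (fun w => g (X w)).
  by move=> bg; exact: bounded_measurable_comp mX bg.
have bhX (g : T -> R) : bounded_measurable g ->
    bounded_measurable (fun w => h w * g (X w)).
  by move=> bg; apply: bounded_measurableM => //; exact: bX.
have int_bm (g : Omega -> R) := @bounded_measurable_integrable _ _ _ P g.
pose H f := \int[P]_w (h w * f (X w)) = c * \int[P]_w f (X w).
apply: (@bounded_measurable_ind _ _ _ H) bf => //.
- move=> f1 f2 b1 b2 e1 e2; rewrite /H.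
  under eq_Rintegral do rewrite mulrDr.
  rewrite !RintegralD//; first by rewrite e1 e2 mulrDr.
  + exact: int_bm (bhX _ b1).
  + exact: int_bm (bhX _ b2).
  + exact: int_bm (bX _ b1).
  + exact: int_bm (bX _ b2).
- move=> r f1 b1 e1; rewrite /H.
  under eq_Rintegral do rewrite mulrCA.
  rewrite !RintegralZl//; first by rewrite e1 mulrCA.
  + exact: int_bm (bhX _ b1).
  + exact: int_bm (bX _ b1).
- move=> f_ f1 K b_ f_K f_f e_; rewrite /H.
  have [mh [L hL]] := bh.
  have m_ k : measurable_fun [set: T] (f_ k) by have [] := b_ k.
  have [_ c1] := bounded_convergence P (f_ := fun k w => f_ k (X w))
    (fun k => measurableT_comp (m_ k) mX) (fun k w => f_K k (X w))
    (fun w => f_f (X w)).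
  have [||_ c2] := bounded_convergence P (f_ := fun k w => h w * f_ k (X w))
    (K := L * K) _ _ (fun w => cvgMr (f_f (X w))).
  - by move=> k; have [] := bhX _ (b_ k).
  - by move=> k w; rewrite normrM ler_pM.
  rewrite (_ : (fun _ => _) = fun k => c * \int[P]_w f_ k (X w)) in c2; last first.
    by apply/funext => k; exact: e_.
  exact: (cvg_unique _ c2 (cvgMr c1)).
Qed.

Lemma Rintegral_indic (A : set Omega) : measurable A ->
  \int[P]_w (\1_A w : R) = fine (P A).
Proof. by move=> mA; rewrite /Rintegral integral_indic// setIT. Qed.

(** Vanishing sine means express symmetry. In the addition formulas every term containing one sine
    mean drops out, so the product rule for characteristic functions stays real. *)
Lemma cos_sum_independent (n : nat) (X : 'I_n -> Omega -> R) (t phi : 'I_n -> R) :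
  (forall i, measurable_fun [set: Omega] (X i)) -> mutually_independent P X ->
  (forall i, \int[P]_w cos (t i * X i w) = phi i) ->
  (forall i, \int[P]_w sin (t i * X i w) = 0) ->
  \int[P]_w cos (\sum_(i < n) t i * X i w) = \prod_(i < n) phi i /\
  \int[P]_w sin (\sum_(i < n) t i * X i w) = 0.
Proof.
move=> mX iX cX sX.
pose S k w := \sum_(i < n | (i < k)%N) t i * X i w.
pose I k (C : 'I_n -> set R) w : R := \prod_(i < n | (k <= i)%N) \1_(C i) (X i w).
have mS k : measurable_fun [set: Omega] (S k).
  rewrite (_ : S k = fun w =>
      \sum_(i <- [seq i : 'I_n <- index_enum 'I_n | (i < k)%N]) t i * X i w).
    by apply: measurable_sum => i; exact: measurable_funM.
  by apply/funext => w; rewrite big_filter.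
have bI k C : (forall i, measurable (C i)) -> bounded_measurable (I k C).
  move=> mC; rewrite (_ : I k C = fun w =>
      \prod_(i <- [seq i : 'I_n <- index_enum 'I_n | (k <= i)%N]) \1_(C i) (X i w)); last first.
    by apply/funext => w; rewrite big_filter.
  elim: (seq.filter _ _) => [|i r IH].
    rewrite (_ : (fun _ => _) = fun=> 1); first exact: bounded_measurable_cst.
    by apply/funext => w; rewrite big_nil.
  rewrite (_ : (fun _ => _) = fun w =>
    \1_(C i) (X i w) * \prod_(i <- r) \1_(C i) (X i w)).
    apply: bounded_measurableM => //.
    exact: bounded_measurable_comp (mX i) (bounded_measurable_indic (mC i)).
  by apply/funext => w; rewrite big_cons.
(* Starting from independence, which is about indicators only, the factors
   [\1_(C i)] are replaced one at a time by [cos] and [sin]. *)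
have step k : (k <= n)%N -> forall C, (forall i, measurable (C i)) ->
    \int[P]_w (cos (S k w) * I k C w) =
    \prod_(i < n | (i < k)%N) phi i *
      \prod_(i < n | (k <= i)%N) \int[P]_w (\1_(C i) (X i w) : R) /\
    \int[P]_w (sin (S k w) * I k C w) = 0.
  elim: k => [_ C mC|k IH kn C mC].
    have mXC i : measurable (X i @^-1` C i).
      by rewrite -[X in measurable X]setTI; exact: mX.
    have S0 w : S 0 w = 0 by rewrite /S big1.
    split; last first.
      under eq_Rintegral do rewrite S0 sin0 mul0r.
      exact: Rintegral_probability_cst.
    under eq_Rintegral do rewrite S0 cos0 mul1r.
    rewrite big1// mul1r.
    have -> : I 0 C = \1_(\bigcap_(i in [set: 'I_n]) (X i @^-1` C i)).
      apply/funext => w; rewrite /I /= indicE.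
      case: (boolP (w \in _)) => [|].
        rewrite inE => wC; rewrite big1// => i _.
        by rewrite indicE mem_set//; exact: wC.
      rewrite notin_setE => wC.
      have [i wi] : exists i, ~ C i (X i w).
        by apply: contrapT => h; apply: wC => i _; apply: contrapT => hi; apply: h; exists i.
      by rewrite (bigD1 i)//= indicE memNset// mul0r.
    rewrite Rintegral_indic; last by apply: fin_bigcap_measurable => // i _; exact: mXC.
    rewrite iX//.
    under [RHS]eq_bigr => i _.
      have -> : \int[P]_w (\1_(C i) (X i w) : R) = fine (P (X i @^-1` C i)).
        by rewrite -Rintegral_indic.
      over.
    rewrite /=.
    have F i : P (X i @^-1` C i) = (fine (P (X i @^-1` C i)))%:E.
      by rewrite fineK// fin_num_measure.
    by under eq_bigr do rewrite F; rewrite prodEFin.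
  pose j := Ordinal kn.
  have SS w : S k.+1 w = S k w + t j * X j w.
    rewrite /S (bigD1 j)//= addrC; congr (_ + _); apply: eq_bigl => i.
    by rewrite -val_eqE/= ltnS; case: ltngtP.
  have IS D w : I k D w = \1_(D j) (X j w) * I k.+1 D w.
    rewrite /I (bigD1 j)//=; congr (_ * _); apply: eq_bigl => i.
    by rewrite -val_eqE/=; case: ltngtP.
  have prS (a : 'I_n -> R) : \prod_(i < n | (i < k.+1)%N) a i =
      \prod_(i < n | (i < k)%N) a i * a j.
    rewrite (bigD1 j)//= mulrC; congr (_ * _); apply: eq_bigl => i.
    by rewrite -val_eqE/= ltnS; case: ltngtP.
  have prI (a : 'I_n -> R) : \prod_(i < n | (k <= i)%N) a i =
      a j * \prod_(i < n | (k < i)%N) a i.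
    rewrite (bigD1 j)//=; congr (_ * _); apply: eq_bigl => i.
    by rewrite -val_eqE/=; case: ltngtP.
  set c := \prod_(i < n | (i < k)%N) phi i *
    \prod_(i < n | (k < i)%N) \int[P]_w (\1_(C i) (X i w) : R).
  have bc : bounded_measurable (fun w => cos (S k w) * I k.+1 C w).
    by apply: bounded_measurableM; [exact: bounded_measurable_cos|exact: bI].
  have bs : bounded_measurable (fun w => sin (S k w) * I k.+1 C w).
    by apply: bounded_measurableM; [exact: bounded_measurable_sin|exact: bI].
  have IHD D : measurable D ->
     \int[P]_w (cos (S k w) * I k.+1 C w * \1_D (X j w)) =
       c * \int[P]_w (\1_D (X j w) : R) /\
     \int[P]_w (sin (S k w) * I k.+1 C w * \1_D (X j w)) =
       0 * \int[P]_w (\1_D (X j w) : R).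
    (* Replacing the j-th test set by [D] turns the induction hypothesis into the factorization over
       indicators of [X j] that [mean_mul_of_indicators] extends to the cosine and the sine. *)
    move=> mD; pose C' i := if i == j then D else C i.
    have [|i|] := IH _ C'; [exact: ltnW|by rewrite /C'; case: ifP|].
    have IC w : I k C' w = I k.+1 C w * \1_D (X j w).
      rewrite IS {1}/C' eqxx mulrC; congr (_ * _); apply: eq_bigr => i ki.
      by rewrite /C'; case: eqP => // ij; rewrite ij ltnn in ki.
    under eq_Rintegral do rewrite IC mulrA.
    move=> -> ; under eq_Rintegral do rewrite IC mulrA.
    move=> ->; rewrite mul0r; split => //.
    rewrite prI {1}/C' eqxx /c -mulrA; congr (_ * _).
    rewrite mulrC; congr (_ * _); apply: eq_bigr => i ki.
    by rewrite /C'; case: eqP => // ij; rewrite ij ltnn in ki.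
  have bct : bounded_measurable (fun x => cos (t j * x)).
    by apply: bounded_measurable_cos; exact: measurable_funM.
  have bst : bounded_measurable (fun x => sin (t j * x)).
    by apply: bounded_measurable_sin; exact: measurable_funM.
  have key h c0 (bh : bounded_measurable h) hD :=
    @mean_mul_of_indicators _ _ _ h c0 (mX j) bh hD.
  have Ecc := key _ _ bc (fun D mD => (IHD D mD).1) _ bct.
  have Ecs := key _ _ bc (fun D mD => (IHD D mD).1) _ bst.
  have Esc := key _ _ bs (fun D mD => (IHD D mD).2) _ bct.
  have Ess := key _ _ bs (fun D mD => (IHD D mD).2) _ bst.
  have bX f : bounded_measurable f -> bounded_measurable (fun w => f (X j w)).
    by move=> bf; exact: bounded_measurable_comp (mX j) bf.
  have int_bm h f : bounded_measurable h -> bounded_measurable f ->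
      P.-integrable [set: Omega] (EFin \o (fun w => h w * f (X j w))).
    move=> bh bf; apply: bounded_measurable_integrable.
    by apply: bounded_measurableM => //; exact: bX.
  split.
    under eq_Rintegral => w _.
      rewrite SS cosD mulrBl (mulrAC (cos _)) (mulrAC (sin _)); over.
    rewrite RintegralB//; [|exact: int_bm bc bct|exact: int_bm bs bst].
    by rewrite Ecc Ess cX mul0r subr0 prS /c mulrAC.
  under eq_Rintegral => w _.
    rewrite SS sinD mulrDl (mulrAC (cos _)) (mulrAC (sin _)); over.
  rewrite RintegralD//; [|exact: int_bm bs bct|exact: int_bm bc bst].
  by rewrite Ecs Esc sX mul0r mulr0 addr0.
have [|] := step n (leqnn n) (fun=> setT) => //.
have Sn w : S n w = \sum_(i < n) t i * X i w.
  by rewrite /S; apply: eq_bigl => i; rewrite ltn_ord.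
have In w : I n (fun=> setT) w = 1.
  by rewrite /I big1// => i _; rewrite indicT.
under eq_Rintegral do rewrite In mulr1 Sn.
move=> ->; under eq_Rintegral do rewrite In mulr1 Sn.
move=> ->; split => //; rewrite [X in _ * X]big_pred0 ?mulr1.
  by apply: eq_bigl => i; rewrite ltn_ord.
by move=> i; rewrite leqNgt ltn_ord.
Qed.

End independence.

(** * Linear combinations of values of a stable random measure *)

Lemma integrable_lincomb_indic {d} {T : measurableType d} {R : realType}
    (kappa : {measure set T -> \bar R}) {J : Type} (r : seq J) (c : J -> R)
    (A : J -> set T) :
  (forall j, measurable (A j)) -> (forall j, (kappa (A j) < +oo)%E) ->
  kappa.-integrable [set: T] (EFin \o (fun x => \sum_(j <- r) c j * \1_(A j) x)) /\
  \int[kappa]_x (\sum_(j <- r) c j * \1_(A j) x) =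
  \sum_(j <- r) c j * fine (kappa (A j)).
Proof.
move=> mA fA.
have i1 j : kappa.-integrable [set: T] (EFin \o (\1_(A j) : T -> R)).
  apply/integrableP; split; first exact/measurable_EFinP/measurable_indic.
  under eq_integral => x _ do rewrite /= ger0_norm ?indicE ?ler0n//.
  by rewrite integral_indic// setIT.
have i2 j : kappa.-integrable [set: T] (EFin \o (fun x => c j * \1_(A j) x)).
  rewrite (_ : _ \o _ = fun x => ((c j)%:E * (\1_(A j) x)%:E)%E).
    exact: integrableZl (i1 j).
  by apply/funext => x /=; rewrite EFinM.
elim: r => [|j r [IHi IHe]].
  rewrite big_nil; split; last first.
    by rewrite /Rintegral; under eq_integral do rewrite big_nil; rewrite integral0.
  rewrite (_ : _ \o _ = cst 0%E); first exact: integrable0.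
  by apply/funext => x /=; rewrite big_nil.
split.
  have := integrableD measurableT (i2 j) IHi; congr (integrable _ _ _).
  by apply/funext => x /=; rewrite big_cons EFinD.
under eq_Rintegral do rewrite big_cons.
rewrite RintegralD// IHe RintegralZl// big_cons; congr (_ * _ + _).
by rewrite /Rintegral integral_indic// setIT.
Qed.

Section sas_random_measure.
Context {d d'} {Omega : measurableType d} {T : measurableType d'} {R : realType}.
Variables (P : probability Omega R) (alpha : R).
Variables (kappa : {measure set T -> \bar R}) (M : set T -> {mfun Omega >-> R}).
Hypothesis alpha0 : 0 < alpha.
Hypothesis hM : is_sas_random_measure P alpha kappa M.

(** Countable additivity for empty sets makes the sequence of multiples k m converge, where m is the
    value at [set0]; its increments m then tend to 0. *)
Let M_set0 : {ae P, forall w, M set0 w = 0}.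
Proof.
have [_ _ /(_ (fun=> set0))] := hM.
have -> : \bigcup_(_ : nat) (set0 : set T) = set0 by apply: bigcup0.
rewrite measure0 ltry => /(_ (fun=> measurable0) _ isT) h.
have {}h := h (@trivIset_set0 _ _ _).
apply: filterS h => w.
under eq_fun do rewrite big_const_nat iter_addr_0 subn0.
set m := M set0 w => cm.
have : (fun k => m *+ k.+1 - m *+ k) @ \oo --> m - m.
  by apply: cvgB => //; move: cm; rewrite -cvg_shiftS.
under eq_fun do rewrite mulrS addrK.
rewrite subrr => /cvg_lim <-//; rewrite lim_cst//.
Qed.

Let M_setU A B : measurable A -> measurable B -> A `&` B = set0 ->
  (kappa (A `|` B) < +oo)%E -> {ae P, forall w, M (A `|` B) w = M A w + M B w}.
Proof.
move=> mA mB AB kAB.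
have [_ _ /(_ (bigcup2 A B))] := hM.
have m2 i : measurable (bigcup2 A B i).
  by rewrite /bigcup2; case: ifP => // _; case: ifP.
rewrite -trivIset_bigcup2 bigcup2E => /(_ m2 AB kAB) h.
apply: filterS2 M_set0 h => w M0 cw.
have cAB : (fun n => \sum_(0 <= i < n) M (bigcup2 A B i) w) @ \oo -->
    M A w + M B w.
  apply: cvg_near_cst; exists 2%N => // -[|[|k]]//= _.
  by rewrite big_nat_recl// big_nat_recl//= big1 ?addr0.
exact: (cvg_unique _ cw cAB).
Qed.

Let M_fibers {F : finType} (pat : T -> F) (L : seq F) :
  (forall S, measurable (pat @^-1` [set S])) -> uniq L ->
  (kappa (pat @^-1` [set` L]) < +oo)%E ->
  {ae P, forall w, M (pat @^-1` [set` L]) w =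
                   \sum_(S <- L) M (pat @^-1` [set S]) w}.
Proof.
move=> mpat.
have mL (l : seq F) : measurable (pat @^-1` [set` l]).
  rewrite (_ : _ @^-1` _ = \bigcup_(S in [set` l]) pat @^-1` [set S]).
    by apply: fin_bigcup_measurable => //; exact: finite_finset.
  rewrite -preimage_bigcup; congr (_ @^-1` _).
  by apply/seteqP; split => [S Sl|S [S' ? ->]]; [exists S|].
elim: L => [_ _|S L IH /= /andP[SL uL]].
  apply: filterS M_set0 => w; rewrite big_nil => <-; congr (M _ w).
  by apply/seteqP; split => x.
have -> : pat @^-1` [set` S :: L] = pat @^-1` [set S] `|` pat @^-1` [set` L].
  apply/seteqP; split => x /=; rewrite in_cons.
    by move=> /predU1P[]; [left|right].
  by move=> [->|->]; rewrite ?eqxx ?orbT.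
move=> kSL.
have /IH{}IH : (kappa (pat @^-1` [set` L]) < +oo)%E.
  apply: le_lt_trans kSL; apply: le_measure;
    [rewrite inE; exact: mL|rewrite inE; exact: measurableU|exact: subsetUr].
have disj : pat @^-1` [set S] `&` pat @^-1` [set` L] = set0.
  by apply/seteqP; split => // x [/= -> h]; move/negP: SL; apply.
apply: filterS2 (IH uL) (M_setU (mpat S) (mL L) disj kSL) => w e1 e2.
by rewrite e2 e1 big_cons.
Qed.

Variables (I : finType) (B : I -> set T) (a : I -> R).
Hypotheses (mB : forall i, measurable (B i)).
Hypotheses (fB : forall i, (kappa (B i) < +oo)%E).

(** The atoms of the [B i] are taken as fibres of a map to a finite type, which makes them disjoint
    by construction. *)
Let pat (x : T) : {set I} := [set i | x \in B i]%SET.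

Let atom (S : {set I}) : set T := pat @^-1` [set S].

Let mpat S : measurable (atom S).
Proof.
have -> : atom S = \bigcap_(i in [set: I]) (if i \in S then B i else ~` B i).
  rewrite /atom; apply/seteqP; split => [x /= xS i _|x xS] /=.
    by rewrite -xS inE; case: ifPn; rewrite ?inE ?notin_setE.
  apply/setP => i; rewrite !inE; have := xS i Logic.I.
  by case: ifP => _ h; [rewrite mem_set|rewrite memNset].
apply: fin_bigcap_measurable; first exact: finite_finset.
by move=> i _; case: ifP => _ //; exact: measurableC.
Qed.

Let coef (S : {set I}) : R := \sum_(i in S) a i.

(** The atom of the empty pattern lies outside all [B i] and may have infinite mass; it is left out,
    and its coefficient is 0. *)
Let fatom S : S != finset.set0 -> (kappa (atom S) < +oo)%E.
Proof.
move=> /finset.set0Pn[i iS]; apply: le_lt_trans (fB i).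
apply: le_measure; rewrite ?inE//.
by rewrite /atom => x /= xS; move: iS; rewrite -xS inE => /set_mem.
Qed.

Let sum_indic_atom x : \sum_i a i * \1_(B i) x = coef (pat x).
Proof.
rewrite /coef [RHS]big_mkcond/=; apply: eq_bigr => i _.
by rewrite inE indicE; case: ifP => _; rewrite ?mulr1 ?mulr0.
Qed.

Let ae_lincomb_atoms : {ae P, forall w, \sum_i a i * M (B i) w =
  \sum_(S : {set I} | S != finset.set0) coef S * M (atom S) w}.
Proof.
have : {ae P, forall w, forall i, M (B i) w = \sum_(S : {set I} | i \in S) M (atom S) w}.
  apply: filter_forall => i.
  have BE : B i = pat @^-1` [set` [seq S : {set I} <- index_enum _ | i \in S]].
    apply/seteqP; split => x /=; rewrite mem_filter inE.
      by move=> xB; rewrite mem_set// mem_index_enum.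
    by move=> /andP[]; rewrite inE.
  have := @M_fibers _ pat [seq S : {set I} <- index_enum _ | i \in S] mpat.
  rewrite filter_uniq ?index_enum_uniq// -BE => /(_ isT (fB i)).
  by apply: filterS => w; rewrite big_filter.
apply: filterS => w e.
under eq_bigr do rewrite e mulr_sumr.
rewrite (exchange_big_dep xpredT)//= [RHS]big_mkcond/=.
apply: eq_bigr => S _; rewrite -mulr_suml -/(coef S); case: ifPn => //.
by rewrite negbK => /eqP ->; rewrite /coef finset.big_set0 mul0r.
Qed.

Let F0 : {set {set I}} := [set S | S != finset.set0]%SET.

(** At most one atom of [F0] contains a given point, so the power acts on a single coefficient. Off
    all the [B i] both sides are 0, because [alpha] is positive. *)
Let powR_norm_atoms x : `|\sum_i a i * \1_(B i) x| `^ alpha =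
  \sum_(S in F0) `|coef S| `^ alpha * \1_(atom S) x.
Proof.
rewrite sum_indic_atom; case: (eqVneq (pat x) finset.set0) => px.
  rewrite px big1 => [|S]; first by rewrite /coef finset.big_set0 normr0 powR0// gt_eqF.
  rewrite inE => S0; rewrite indicE memNset ?mulr0//= => xS.
  by rewrite -xS px eqxx in S0.
rewrite (bigD1 (pat x)) ?inE//= big1 => [|S /andP[_ Sx]].
  by rewrite indicE mem_set// mulr1 addr0.
rewrite indicE memNset ?mulr0//= => xS.
by rewrite -xS eqxx in Sx.
Qed.

Lemma sas_lincomb : has_sas_law P alpha
  ((\int[kappa]_x `|\sum_i a i * \1_(B i) x| `^ alpha) `^ alpha^-1)
  (fun w => \sum_i a i * M (B i) w).
Proof.
set s := \int[kappa]_x _.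
(* Independence is stated for families indexed by ordinals, so the nonempty patterns are
   enumerated. *)
pose N := #|F0|; pose D (k : 'I_N) := atom (enum_val k).
pose c (k : 'I_N) := coef (enum_val k).
have D0 (k : 'I_N) : enum_val k != finset.set0 :> {set I}.
  by have := enum_valP k; rewrite inE.
have fD k : (kappa (D k) < +oo)%E by exact: fatom.
have s0 : 0 <= s by apply: Rintegral_ge0 => x _; exact: powR_ge0.
have sE : s = \sum_(k < N) `|c k| `^ alpha * fine (kappa (D k)).
  rewrite -(integrable_lincomb_indic (kappa := kappa) _ _ (fun k => mpat _) fD).2.
  apply: eq_Rintegral => x _; rewrite powR_norm_atoms big_enum_val/=.
  by apply: eq_bigr.
have [law indep _] := hM.
have /indep {}indep : forall k, measurable (D k) by move=> k; exact: mpat.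
have iX := indep fD; move=> theta.
have tD : trivIset [set: 'I_N] D.
  move=> j k _ _ [x [/= xj xk]]; apply: enum_val_inj.
  exact: etrans (esym xj) xk.
have {iX} := iX tD.
have mMD k : measurable_fun [set: Omega] (M (D k)) by [].
have lawD k : char_fun P (M (D k)) (theta * c k) =
    Complex (expR (- (fine (kappa (D k)) * `|theta * c k| `^ alpha))) 0.
  rewrite law//; last exact: mpat.
  by rewrite -powRrM mulVf ?gt_eqF// powRr1// fine_ge0.
move=> iX.
have [ec es] := cos_sum_independent mMD iX
  (fun k => f_equal (@complex.Re R) (lawD k) : _ = expR _)
  (fun k => f_equal (@complex.Im R) (lawD k)).
have aeE : {ae P, forall w, theta * \sum_i a i * M (B i) w =
    \sum_(k < N) theta * c k * M (D k) w}.
  apply: filterS ae_lincomb_atoms => w ->; rewrite mulr_sumr.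
  rewrite (eq_bigl (fun S => S \in F0)); last by move=> S; rewrite inE.
  by rewrite big_enum_val/=; apply: eq_bigr => k _; rewrite mulrA.
have m1 : measurable_fun [set: Omega] (fun w => theta * \sum_i a i * M (B i) w).
  by apply: measurable_funM => //; apply: measurable_sum => i; exact: measurable_funM.
have m2 : measurable_fun [set: Omega] (fun w => \sum_(k < N) theta * c k * M (D k) w).
  by apply: measurable_sum => i; exact: measurable_funM.
have aeI (f : R -> R) : measurable_fun [set: R] f ->
    \int[P]_w f (theta * \sum_i a i * M (B i) w) =
    \int[P]_w f (\sum_(k < N) theta * c k * M (D k) w).
  move=> mf; congr fine; apply: ae_eq_integral => //.
  - by apply/measurable_EFinP; exact: measurableT_comp mf m1.
  - by apply/measurable_EFinP; exact: measurableT_comp mf m2.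
  - by apply: filterS aeE => w -> _.
rewrite /char_fun !aeI//; last 2 first.
- exact: (continuous_measurable_fun (@continuous_sin R)).
- exact: (continuous_measurable_fun (@continuous_cos R)).
rewrite ec es; congr Complex.
rewrite -powRrM mulVf ?gt_eqF// powRr1// -expR_sum; congr expR.
rewrite sumrN sE mulr_suml; congr (- _); apply: eq_bigr => k _.
by rewrite normrM powRM//; ring.
Qed.

End sas_random_measure.

(** * Counts of a Poisson process and the Karlin measure *)

Section point_measure_counts.
Context {d} {E : measurableType d} {R : realType}.
Implicit Types (A B : set E) (m : point_measure E R).

(** The mass is the number of indices whose Dirac mass sits in [A]. *)
Lemma point_measure_count m A : measurable A ->
  m A = +oo%E \/ exists k : nat, m A = k%:R%:E.
Proof.
move=> mA; have [I [x mE]] := pm_measureP m.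
have -> : m A = counting (I `&` x @^-1` A).
  rewrite mE// counting_dirac nneseries_esumT//.
  rewrite esum_mkcond; apply: eq_esum => i _.
  rewrite !diracE; case: (boolP (i \in I)) => iI; last first.
    by rewrite memNset// => -[/mem_set]; rewrite (negbTE iI).
  congr ((nat_of_bool _)%:R%:E); apply/idP/idP; rewrite !inE /=.
    by move=> Ax; split => //; rewrite -inE.
  by case.
rewrite /counting; case: ifP => _; last by left.
by right; eexists.
Qed.

Lemma measurable_pm_ev A : measurable A ->
  measurable_fun [set: point_measure E R] (pm_ev A).
Proof.
move=> mA _ Y mY; apply: sub_sigma_algebra.
by exists A => //; exists Y.
Qed.

Lemma measurable_count A (c : \bar R) : measurable A ->
  measurable [set m : point_measure E R | m A = c].
Proof.
move=> mA; have := measurable_pm_ev mA measurableT (emeasurable_set1 c).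
by rewrite setTI.
Qed.

Lemma odd_countE A : odd_count A =
  \bigcup_(k in [set k | odd k]) [set m : point_measure E R | m A = k%:R%:E].
Proof. by apply/seteqP; split => m; case=> k; exists k. Qed.

Lemma measurable_odd_count A : measurable A ->
  measurable (odd_count A : set (point_measure E R)).
Proof.
move=> mA; rewrite odd_countE; apply: bigcup_measurable => k _.
exact: measurable_count.
Qed.

Lemma odd_countP m A k : m A = k%:R%:E -> odd_count A m <-> odd k.
Proof.
move=> mk; split=> [[j oj]|ok]; last by exists k.
by rewrite mk => -[/eqP]; rewrite eqr_nat => /eqP ->.
Qed.

(** With a, b, c the counts of the two differences and of the intersection, a + b has the parity of
    (a + c) + (b + c). Finiteness matters: two infinite counts, neither odd, can leave an odd
    symmetric difference. *)
Lemma odd_count_setY m A B : measurable A -> measurable B ->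
  m A <> +oo%E -> m B <> +oo%E ->
  (m \in odd_count (A `+` B)) = (m \in odd_count A) (+) (m \in odd_count B).
Proof.
move=> mA mB fA fB.
have cnt C : measurable C -> m C <> +oo%E -> exists k : nat, m C = k%:R%:E.
  by move=> mC fC; have [|] := point_measure_count m mC.
have le_fin C D : measurable C -> measurable D -> C `<=` D -> m D <> +oo%E -> m C <> +oo%E.
  move=> mC mD CD fD mCy; apply: fD; apply/eqP; rewrite -leye_eq -mCy.
  by apply: le_measure; rewrite ?inE.
have [mAB mBA mI] : [/\ measurable (A `\` B), measurable (B `\` A) & measurable (A `&` B)].
  by split; [exact: measurableD|exact: measurableD|exact: measurableI].
have [a ma] := cnt _ mAB (le_fin _ _ mAB mA (@subDsetl _ _ _) fA).
have [b mb] := cnt _ mBA (le_fin _ _ mBA mB (@subDsetl _ _ _) fB).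
have [c mc] := cnt _ mI (le_fin _ _ mI mA (@subIsetl _ _ _) fA).
have oddE C k : m C = k%:R%:E -> (m \in odd_count C) = odd k.
  by move=> mk; apply/idP/idP; rewrite ?inE => /(odd_countP mk).
have mU C D : measurable C -> measurable D -> C `&` D = set0 ->
    m (C `|` D) = (m C + m D)%E by move=> mC mD CD; exact: measureU.
have EA : m A = (a + c)%:R%:E.
  rewrite -[in LHS](setUIDK A B) mU// ?mc ?ma -?EFinD -?natrD ?(addnC c)//.
  by apply/seteqP; split => // x [] [] _ Bx [] _ /(_ Bx).
have EB : m B = (b + c)%:R%:E.
  rewrite -[in LHS](setUIDK B A) (setIC B) mU// ?mc ?mb -?EFinD -?natrD ?(addnC c)//.
  by apply/seteqP; split => // x [] [] Ax _ [] _ /(_ Ax).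
have EY : m (A `+` B) = (a + b)%:R%:E.
  rewrite setY_def mU// ?ma ?mb -?EFinD -?natrD//.
  by apply/seteqP; split => // x [] [] Ax nBx [] Bx.
rewrite (oddE _ _ EA) (oddE _ _ EB) (oddE _ _ EY) !oddD.
by case: (odd a); case: (odd b); case: (odd c).
Qed.

Section poisson_law.
Variables (nu : {measure set E -> \bar R}) (Q : probability (point_measure E R) R).
Hypothesis hQ : is_poisson_process_law nu Q.
Variable A : set E.
Hypotheses (mA : measurable A) (fA : (nu A < +oo)%E).

Lemma poisson_count (K : set nat) :
  Q (\bigcup_(k in K) [set m : point_measure E R | m A = k%:R%:E]) =
  poisson_prob (fine (nu A)) 0 K.
Proof.
have [hk _ _] := hQ.
rewrite measure_bigcup//; last 2 first.
- by move=> k _; exact: measurable_count.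
- move=> i j _ _ [m [/= -> [/eqP]]]; rewrite eqr_nat => /eqP ->//.
have {2}-> : K = \bigcup_(k in K) [set k] by rewrite bigcup_imset1 image_id.
rewrite measure_bigcup//; last by move=> i j _ _ [m [/= -> ->]].
by apply: eq_eseriesr => k _; exact: hk.
Qed.

Lemma poisson_odd_count :
  Q (odd_count A) = poisson_prob (fine (nu A)) 0 [set k | odd k].
Proof. by rewrite odd_countE poisson_count. Qed.

(** The finite counts already exhaust the total Poisson probability. *)
Lemma poisson_count_finite : Q [set m | m A = +oo%E] = 0%E.
Proof.
rewrite [X in Q X](_ : _ =
    ~` \bigcup_(k in [set: nat]) [set m : point_measure E R | m A = k%:R%:E]); last first.
  apply/seteqP; split => m /=; first by move=> my [k _] /=; rewrite my.
  have [//|[k mk] h] := point_measure_count m mA.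
  by exfalso; apply: h; exists k.
rewrite probability_setC; last first.
  by apply: bigcup_measurable => k _; exact: measurable_count.
by rewrite poisson_count probability_setT subee.
Qed.

End poisson_law.
End point_measure_counts.

(** * Odd values of a Poisson variable as a function of its rate *)

Section poisson_odd.
Context {R : realType}.

(** An odd count is nonzero, which has probability 1 - exp(-l) <= l. *)
Lemma poisson_odd_le (l : R) : 0 <= l ->
  (poisson_prob l 0 [set k | odd k] <= (Num.min 1 l)%:E)%E.
Proof.
rewrite EFin_min le_min => l0; apply/andP; split; first exact: probability_le1.
move: l0; rewrite le_eqVlt => /predU1P[<-|l0].
  (* At rate 0 [poisson_prob] is the Dirac mass at 0, an even number. *)
  by rewrite /poisson_prob ltxx diracE memNset.
have -> : [set k | odd k] = ~` [set k | ~~ odd k].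
  by apply/seteqP; split => k /=; [move=> -> | move=> /negP; rewrite negbK].
rewrite probability_setC// leeBlDr//; last exact: fin_num_measure.
apply: (@le_trans _ _ (l%:E + poisson_prob l 0 [set 0%N])%E).
  rewrite /poisson_prob l0 esum_set1; last by rewrite lee_fin poisson_pmf_ge0.
  rewrite /poisson_pmf l0 expr0 fact0 invr1 !mul1r -EFinD lee_fin.
  by have := expR_ge1Dx (- l); lra.
rewrite leeD2l//; apply: le_measure; rewrite ?inE//.
by move=> k ->.
Qed.

Lemma measurable_poisson_prob_rate (c : R) (K : set nat) :
  measurable_fun [set: R] (fun r => poisson_prob (r * c) 0 K).
Proof.
suff mp : measurable_fun [set: R] (fun t : R => poisson_prob t 0 K).
  by apply: (measurableT_comp mp); exact: measurable_funM.
apply: measurable_fun_if => //=; first exact: measurable_fun_ltr.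
apply: (eq_measurable_fun (fun t =>
    \sum_(k <oo | k \in K) (poisson_pmf t k)%:E))%E.
  move=> x _.
  by rewrite nneseries_esum ?set_mem_set// =>*; rewrite lee_fin poisson_pmf_ge0.
apply: ge0_emeasurable_sum.
  by move=> k x _ _; rewrite lee_fin poisson_pmf_ge0.
move=> k Kk; apply/measurableT_comp => //.
apply: measurable_poisson_pmf => //.
rewrite setTI (_ : _ @^-1` _ = `]0, +oo[%classic)//.
by apply/seteqP; split => /= x /=; rewrite in_itv/= andbT.
Qed.

End poisson_odd.

(** * Integrability against r^(-beta-1) *)

Section karlin.
Context {R : realType}.

Lemma integral_powR (a b p : R) : 0 < a < b -> p != 0 ->
  (\int[@lebesgue_measure R]_(r in `[a, b]) (r `^ (p - 1))%:E =
   ((b `^ p - a `^ p) / p)%:E)%E.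
Proof.
move=> /andP[a0 ab] p0.
have pos r : r \in `[a, b]%classic -> 0 < r.
  by rewrite inE/= in_itv/= => /andP[ar _]; exact: lt_le_trans ar.
have dF (q : R) (r : R) : 0 < r -> is_derive r 1 (fun x => x `^ q) (q * r `^ (q - 1)).
  by move=> r0; exact: is_derive1_powR.
have cF (q : R) (r : R) : 0 < r -> {for r, continuous (fun x => x `^ q)}.
  move=> r0; apply/differentiable_continuous/derivable1_diffP.
  by have [] := dF q r r0.
rewrite (@continuous_FTC2 _ _ (fun x => x `^ p / p))//.
- by rewrite -EFinB mulrBl.
- apply: continuous_in_subspaceT => r /pos; exact: cF.
- split.
  + move=> r; rewrite in_itv/= => /andP[ar _].
    apply: derivableM => //; have [] := dF p r (lt_trans a0 ar); done.
  + apply: cvgMl; apply: cvg_at_right_filter; exact: cF.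
  + apply: cvgMl; apply: cvg_at_left_filter; apply: cF; exact: lt_trans ab.
- move=> r; rewrite in_itv/= => /andP[ar _].
  have r0 := lt_trans a0 ar.
  rewrite derive1E deriveM//; last by have [] := dF p r r0.
  rewrite derive_cst scaler0 add0r.
  have [_ ->] := dF p r r0.
  by rewrite /GRing.scale/= mulrA mulVf ?mul1r.
Qed.

Lemma karlin_integral_lty (beta l : R) (g : R -> R) : 0 < beta < 1 -> 0 <= l ->
  measurable_fun (`]0, +oo[%classic : set R) g ->
  (forall r, 0 < r -> 0 <= g r <= r `^ (- beta - 1) * Num.min 1 (r * l)) ->
  (\int[@lebesgue_measure R]_(r in `]0%R, +oo[) (g r)%:E < +oo)%E.
Proof.
move=> /andP[b0 b1] l0 mg hg.
(* Starting at n + 2 keeps 1 strictly inside every interval, so each can be split there. *)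
pose F (n : nat) : set R := `[n.+2%:R^-1, n.+2%:R]%classic.
have F0 n r : F n r -> 0 < r.
  by rewrite /F/= in_itv/= => /andP[+ _]; apply: lt_le_trans; rewrite invr_gt0.
have mF n : measurable_fun (F n) (EFin \o g).
  apply/measurable_EFinP; apply: measurable_funS mg => // r /F0 r0.
  by rewrite /= in_itv/= r0.
have -> : `]0, +oo[%classic = \bigcup_n F n.
  apply/seteqP; split => [r|r [n _ /F0 r0]]; rewrite /= in_itv/= andbT// => r0.
  exists (Num.truncn (r + r^-1)) => //; rewrite /F/= in_itv/=.
  have := truncnS_gt (r + r^-1); set N := Num.truncn _ => hN.
  have hN2 : r + r^-1 < N.+2%:R by rewrite (lt_trans hN)// ltr_nat.
  have ri0 : 0 < r^-1 by rewrite invr_gt0.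
  apply/andP; split; last by lra.
  by rewrite -[leRHS]invrK lef_pV2 ?posrE ?invr_gt0// ?ltr0n//; lra.
have homoF : {homo F : n m / (n <= m)%N >-> (n <= m)%O}.
  move=> n m nm; rewrite subsetEset => r; rewrite /F/= !in_itv/= => /andP[h1 h2].
  apply/andP; split.
    by rewrite (le_trans _ h1)// lef_pV2 ?posrE ?ltr0n// ler_nat.
  by rewrite (le_trans h2)// ler_nat.
have cvgF : (\int[@lebesgue_measure R]_(r in F n) (g r)%:E)%E @[n --> \oo] -->
    (\int[@lebesgue_measure R]_(r in \bigcup_n F n) (g r)%:E)%E.
  apply: ge0_nondecreasing_set_cvg_integral => //.
    by move=> n; exact: measurable_itv.
  by move=> i r /F0 /hg /andP[]; rewrite lee_fin.
rewrite -(cvg_lim (@ereal_hausdorff R) cvgF).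
(* The two terms are the integrals of l r^(-beta) over ]0, 1] and of r^(-beta-1) over [1, +oo[,
   which bound all truncated integrals. *)
apply: (@le_lt_trans _ _ (l / (1 - beta) + 1 / beta)%:E); last exact: ltry.
apply: lime_le; first exact: cvgP cvgF.
apply: nearW => n.
have -> : F n = `[n.+2%:R^-1, 1%R]%classic `|` `]1%R, n.+2%:R]%classic.
  rewrite -itv_bndbnd_setU// bnd_simp ?invf_le1 ?ltr0n ?ler1n//.
have n21 : (1 : R) < n.+2%:R by rewrite ltr1n.
have n20 : 0 < (n.+2%:R : R)^-1 < 1 by rewrite invr_gt0 ltr0n/= invf_lt1 ?ltr0n.
have bound (a b p K : R) : 0 < a < b -> p != 0 -> 0 <= K ->
    (forall r, a <= r <= b -> g r <= K * r `^ (p - 1)) ->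
    (\int[@lebesgue_measure R]_(r in `[a, b]) (g r)%:E <=
     (K * ((b `^ p - a `^ p) / p))%:E)%E.
  move=> ab p0 K0 gK; rewrite EFinM -integral_powR//.
  have pos r : `[a, b]%classic r -> 0 < r.
    by rewrite /= in_itv/= => /andP[ar _]; move/andP: ab => [a0 _]; exact: lt_le_trans ar.
  rewrite -ge0_integralZl//; last 2 first.
  - apply/measurable_EFinP; apply: measurable_funTS; exact: measurable_powR.
  - by move=> r _; rewrite lee_fin powR_ge0.
  apply: ge0_le_integral => //.
  - by move=> r /pos /hg /andP[]; rewrite lee_fin.
  - apply/measurable_EFinP; apply: measurable_funS mg => // r /pos r0.
    by rewrite /= in_itv/= r0.
  - apply/measurable_EFinP; apply: measurable_funM => //.
    apply: measurable_funTS; exact: measurable_powR.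
rewrite ge0_integral_setU//=; last 3 first.
- apply/measurable_EFinP; apply: measurable_funS mg => // r /=.
  rewrite !in_itv/= => -[/andP[+ _]|/andP[+ _]]; rewrite andbT.
    by apply: lt_le_trans; case/andP: n20.
  exact: lt_trans.
- move=> r [|]; rewrite /= in_itv/= => /andP[h _]; rewrite lee_fin.
    have r0 : 0 < r by apply: lt_le_trans h; case/andP: n20.
    by have /andP[] := hg _ r0.
  by have /andP[] := hg _ (lt_trans ltr01 h).
- apply/disj_setPS => r [/=]; rewrite !in_itv/= => /andP[_ r1] /andP[r2 _].
  by rewrite leNgt r2 in r1.
rewrite EFinD; apply: leeD.
  apply: (le_trans (@bound _ 1 (1 - beta) l n20 _ l0 _)).
  - by rewrite gt_eqF// subr_gt0.
  - move=> r /andP[ar _]; have r0 : 0 < r by apply: lt_le_trans ar; case/andP: n20.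
    have /andP[_ /le_trans] := hg _ r0; apply.
    rewrite (_ : 1 - beta - 1 = (- beta - 1) + 1); last by ring.
    rewrite (@powRD _ r (- beta - 1) 1); last by rewrite (gt_eqF r0) implybT.
    rewrite powRr1 ?(ltW r0)// (mulrCA l) ler_wpM2l ?powR_ge0//.
    by rewrite (mulrC l) ge_min lexx orbT.
  - rewrite lee_fin powR1/= ler_wpM2l// ler_piMl ?invr_ge0 ?subr_ge0 ?(ltW b1)//.
rewrite integral_itv_obnd_cbnd; last first.
  apply/measurable_EFinP; apply: measurable_funS mg => // r /=.
  by rewrite !in_itv/= andbT => /andP[+ _]; exact: lt_trans.
have n12 : 0 < (1 : R) < n.+2%:R by rewrite ltr01.
apply: (le_trans (@bound _ _ (- beta) 1 n12 _ _ _)) => //.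
- by rewrite oppr_eq0 gt_eqF.
- move=> r /andP[r1 _]; have r0 : 0 < r by exact: lt_le_trans r1.
  have /andP[_ /le_trans] := hg _ r0; apply.
  by rewrite mul1r ler_piMr ?powR_ge0// ge_min lexx.
- rewrite lee_fin powR1/= !mul1r invrN mulrN -mulNr opprB ler_pdivrMr//.
  by rewrite mulVf ?gt_eqF// gerBl powR_ge0.
Qed.

End karlin.

(** * Fourier inversion on the cube and stationarity *)

Section walsh.
Context {R : realType} {I : finType}.

(** The characters of the group of subsets of [I] under symmetric difference. *)
Definition walsh (J S : {set I}) : R := \prod_(i in J) (-1) ^+ (i \in S).

(** The sum over [J] expands a product of factors 1 + u_i with u_i a sign. All factors are 2 when
    the sets agree, and an index where they differ gives a factor 0. *)
Lemma walsh_orthogonal (S0 S : {set I}) :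
  \sum_(J : {set I}) walsh J S0 * walsh J S = (S0 == S)%:R * 2 ^+ #|I|.
Proof.
pose u i : R := (-1) ^+ (i \in S0) * (-1) ^+ (i \in S).
transitivity (\prod_i (u i + 1)).
  rewrite bigA_distr; apply: eq_bigr => J _.
  rewrite /walsh -big_split/= [LHS]big_mkcond; apply: eq_bigr => i _.
  by case: ifP.
have [e|S0S] := eqVneq S0 S.
  rewrite mul1r -[RHS](prodr_const I); apply: eq_bigr => i _.
  by rewrite /u e -signr_addb addbb expr0; ring.
rewrite mul0r; have [i Hi] : exists i, (i \in S0) != (i \in S).
  apply/existsP; apply: contraNT S0S; rewrite negb_exists => /forallP h.
  by apply/eqP/setP => i; have := h i; rewrite negbK => /eqP.
rewrite (bigD1 i)//= /u -signr_addb (_ : _ (+) _ = true) ?expr1 ?addNr ?mul0r//.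
by move: Hi; case: (_ \in _); case: (_ \in _).
Qed.

Lemma walsh_parity (J S : {set I}) :
  (\big[addb/false]_(i in J) (i \in S))%:R = (1 - walsh J S) / 2.
Proof.
have -> : walsh J S = (-1) ^+ (\big[addb/false]_(i in J) (i \in S)).
  symmetry; apply: (big_morph (fun b : bool => (-1) ^+ b : R)) => [b1 b2|].
    exact: signr_addb.
  exact: expr0.
by case: (\big[_/_]_(_ in _) _); rewrite ?expr1 ?expr0/=; field.
Qed.

(* Walsh-Hadamard inversion. *)
Lemma parity_expansion (h : {set I} -> R) : h finset.set0 = 0 ->
  exists c : {set I} -> R, forall S,
    h S = \sum_(J : {set I}) c J * (\big[addb/false]_(i in J) (i \in S))%:R.
Proof.
move=> h0; have N0 : 2 ^+ #|I| != 0 :> R by rewrite expf_neq0.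
pose H (J : {set I}) : R := \sum_(S0 : {set I}) h S0 * walsh J S0.
(* Subtracting the inversion formula at the empty set, where [h] is 0, replaces each character by
   the character minus 1, which is -2 times a parity. *)
exists (fun J => - 2 / 2 ^+ #|I| * H J) => S.
have inv S1 : \sum_(J : {set I}) H J * walsh J S1 = h S1 * 2 ^+ #|I|.
  rewrite /H; under eq_bigr do rewrite mulr_suml.
  rewrite exchange_big/= (bigD1 S1)//= [X in _ + X]big1 => [|S0 S01].
    under eq_bigr do rewrite -mulrA.
    by rewrite -mulr_sumr walsh_orthogonal eqxx mul1r addr0.
  under eq_bigr do rewrite -mulrA.
  by rewrite -mulr_sumr walsh_orthogonal (negbTE S01) mul0r mulr0.
have w0 J : walsh J finset.set0 = 1.
  by rewrite /walsh big1// => i _; rewrite inE expr0.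
transitivity (\sum_(J : {set I})
    (2 ^+ #|I|)^-1 * (H J * walsh J S - H J * walsh J finset.set0)).
  by rewrite -mulr_sumr sumrB !inv h0 mul0r subr0 mulrC mulfK.
by apply: eq_bigr => J _; rewrite walsh_parity w0; field.
Qed.

End walsh.

Lemma in_big_setY {T : Type} {I : finType} (J : {set I}) (O : I -> set T) x :
  (x \in \big[@setY T/set0]_(i in J) O i) = \big[addb/false]_(i in J) (x \in O i).
Proof.
apply: (big_morph (fun A => x \in A)) => [A B|]; last by rewrite in_set0.
rewrite setY_def in_setU !in_setD.
by case: (x \in A); case: (x \in B).
Qed.

Section powR_lincomb_integral.
Context {d} {T : measurableType d} {R : realType}.
Variables (kappa : {measure set T -> \bar R}) (alpha : R).
Variables (I : finType) (c : I -> R) (O O' : I -> set T).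
Hypothesis alpha0 : 0 < alpha.

Let symdiff (U : I -> set T) (J : {set I}) := \big[@setY T/set0]_(i in J) U i.

Lemma measurable_big_setY (U : I -> set T) (J : {set I}) :
  (forall i, measurable (U i)) -> measurable (symdiff U J).
Proof.
move=> mU; rewrite /symdiff; elim/big_ind: _ => // A B mA mB.
by rewrite setY_def; apply: measurableU; exact: measurableD.
Qed.

(** The coefficients [b] depend on [c] and [alpha] but not on the sets, so both integrals are the
    same linear function of the masses of symmetric differences. *)
Lemma eq_integral_powR_lincomb :
  (forall i, measurable (O i)) -> (forall i, measurable (O' i)) ->
  (forall J, (kappa (symdiff O J) < +oo)%E) ->
  (forall J, kappa (symdiff O J) = kappa (symdiff O' J)) ->
  \int[kappa]_x `|\sum_i c i * \1_(O i) x| `^ alpha =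
  \int[kappa]_x `|\sum_i c i * \1_(O' i) x| `^ alpha.
Proof.
move=> mO mO' fO eO.
pose h (S : {set I}) : R := `|\sum_(i in S) c i| `^ alpha.
have [|b hb] := @parity_expansion _ _ h.
  by rewrite /h finset.big_set0 normr0 powR0// gt_eqF.
have E (U : I -> set T) : (forall i, measurable (U i)) ->
    (forall J, (kappa (symdiff U J) < +oo)%E) ->
    \int[kappa]_x `|\sum_i c i * \1_(U i) x| `^ alpha =
    \sum_(J : {set I}) b J * fine (kappa (symdiff U J)).
  move=> mU fU.
  rewrite -(integrable_lincomb_indic (kappa := kappa) _ _
    (fun J => measurable_big_setY J mU) fU).2.
  apply: eq_Rintegral => x _.
  have := hb [set i | x \in U i]%SET; rewrite /h.
  have -> : \sum_(i in [set i | x \in U i]%SET) c i = \sum_i c i * \1_(U i) x.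
    rewrite [LHS]big_mkcond/=; apply: eq_bigr => i _.
    by rewrite inE indicE; case: ifP => _; rewrite ?mulr1 ?mulr0.
  move=> ->; apply: eq_bigr => J _; rewrite indicE in_big_setY.
  by congr (_ * (nat_of_bool _)%:R); apply: eq_bigr => i _; rewrite inE.
rewrite (E O)// (E O')//; last by move=> J; rewrite -eO.
by apply: eq_bigr => J _; rewrite eO.
Qed.

End powR_lincomb_integral.

Lemma ae_eq_measure {d} {T : measurableType d} {R : realType}
    (kappa : {measure set T -> \bar R}) (U V : set T) :
  measurable U -> measurable V ->
  {ae kappa, forall x, (x \in U) = (x \in V)} -> kappa U = kappa V.
Proof.
move=> mU mV UV; rewrite -(setIT U) -(setIT V) -!integral_indic//.
apply: ae_eq_integral => //.
- exact/measurable_EFinP/measurable_indic.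
- exact/measurable_EFinP/measurable_indic.
- by apply: filterS UV => x e _; rewrite !indicE e.
Qed.

Lemma measure_setY_lty {d} {T : measurableType d} {R : realType}
    (kappa : {measure set T -> \bar R}) (U V : set T) :
  measurable U -> measurable V -> (kappa U < +oo)%E -> (kappa V < +oo)%E ->
  (kappa (U `+` V) < +oo)%E.
Proof.
move=> mU mV fU fV.
apply: (@le_lt_trans _ _ (kappa U + kappa V)%E); last exact: lte_add_pinfty.
apply: le_trans (measureU2 _ mU mV); apply: le_measure; rewrite ?inE.
- by rewrite setY_def; apply: measurableU; exact: measurableD.
- exact: measurableU.
- by rewrite setYE; exact: subDsetl.
Qed.

(** * The Karlin measure of sets of odd count *)

Section karlin_measure.
Context {R : realType} {d} {E : measurableType d}.
Variables (beta : R) (mu : {measure set E -> \bar R}).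
Variables (PP : R -> probability (point_measure E R) R).
Variable mu_beta : {measure set (point_measure E R) -> \bar R}.
Hypothesis hbeta : 0 < beta < 1.
Hypothesis hPP : forall (r : R) (hr : 0 < r),
  is_poisson_process_law (mscale (NngNum (ltW hr)) mu) (PP r).
Hypothesis hmu_beta : forall B, measurable B -> mu_beta B = karlin_measure beta PP B.
Implicit Types A B : set E.

Let scale_fin A r (hr : 0 < r) : (mu A < +oo)%E ->
  (mscale (NngNum (ltW hr)) mu A < +oo)%E /\
  fine (mscale (NngNum (ltW hr)) mu A) = r * fine (mu A).
Proof.
move=> fA; rewrite /mscale/=.
have /fineK <- : mu A \is a fin_num by rewrite ge0_fin_numE.
by rewrite -EFinM ltry.
Qed.

Let PP_odd A r : 0 < r -> measurable A -> (mu A < +oo)%E ->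
  PP r (odd_count A) = poisson_prob (r * fine (mu A)) 0 [set k | odd k].
Proof.
move=> hr mA fA; have [fs <-] := scale_fin hr fA.
exact: (poisson_odd_count (hPP hr)).
Qed.

Lemma karlin_odd_count A B : measurable A -> measurable B -> (mu A < +oo)%E ->
  mu A = mu B -> mu_beta (odd_count A) = mu_beta (odd_count B).
Proof.
move=> mA mB fA AB; rewrite !hmu_beta; [|exact: measurable_odd_count..].
rewrite /karlin_measure; congr (_ * _)%E; apply: eq_integral => r.
by rewrite inE/= in_itv/= andbT => r0; rewrite !PP_odd// -?AB.
Qed.

Lemma karlin_count_finite A : measurable A -> (mu A < +oo)%E ->
  {ae mu_beta, forall m : point_measure E R, m A <> +oo%E}.
Proof.
move=> mA fA; exists [set m : point_measure E R | m A = +oo%E]; split.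
- exact: measurable_count.
- rewrite hmu_beta; last exact: measurable_count.
  rewrite /karlin_measure integral0_eq ?mule0// => r.
  rewrite /= in_itv/= andbT => r0.
  by rewrite (poisson_count_finite (hPP r0) mA (scale_fin r0 fA).1) mule0.
- by move=> m /= /contrapT.
Qed.

Lemma karlin_odd_count_lty A : measurable A -> (mu A < +oo)%E ->
  (mu_beta (odd_count A) < +oo)%E.
Proof.
move=> mA fA; rewrite hmu_beta; last exact: measurable_odd_count.
have l0 : 0 <= fine (mu A) by exact: fine_ge0.
pose g r := r `^ (- beta - 1) *
  fine (poisson_prob (r * fine (mu A)) 0 [set k | odd k]) : R.
have fg r : poisson_prob (r * fine (mu A)) 0 [set k | odd k] \is a fin_num.
  by apply: (fin_num_measure (poisson_prob (r * fine (mu A)) 0)).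
rewrite /karlin_measure.
have -> : (\int[@lebesgue_measure R]_(r in `]0%R, +oo[)
    ((r `^ (- beta - 1))%:E * PP r (odd_count A)) =
    \int[@lebesgue_measure R]_(r in `]0%R, +oo[) (g r)%:E)%E.
  apply: eq_integral => r; rewrite inE/= in_itv/= andbT => r0.
  by rewrite PP_odd// /g EFinM fineK.
have gge r : 0 < r -> 0 <= g r.
  by move=> r0; rewrite mulr_ge0// ?powR_ge0//= fine_ge0.
have lty : (\int[@lebesgue_measure R]_(r in `]0%R, +oo[) (g r)%:E < +oo)%E.
  apply: (karlin_integral_lty hbeta l0).
    apply: measurable_funTS; apply: measurable_funM; first exact: measurable_powR.
    apply: measurableT_comp => //; exact: measurable_poisson_prob_rate.
  move=> r r0; rewrite gge//= ler_wpM2l ?powR_ge0// -lee_fin fineK//.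
  by apply: poisson_odd_le; rewrite mulr_ge0// ltW.
have /fineK <- : (\int[@lebesgue_measure R]_(r in `]0%R, +oo[) (g r)%:E)%E \is a fin_num.
  rewrite ge0_fin_numE//; apply: integral_ge0 => r.
  by rewrite /= in_itv/= andbT => /gge; rewrite lee_fin.
by rewrite -EFinM ltry.
Qed.

Variables (I : finType).

Lemma big_setY_lty (B : I -> set E) (J : {set I}) :
  (forall i, measurable (B i)) -> (forall i, (mu (B i) < +oo)%E) ->
  (mu (\big[@setY E/set0]_(i in J) B i) < +oo)%E.
Proof.
move=> mB fB.
suff [] : measurable (\big[@setY E/set0]_(i in J) B i) /\
  (mu (\big[@setY E/set0]_(i in J) B i) < +oo)%E by [].
elim/big_ind: _ => [|U V [mU fU] [mV fV]|i _]; [by rewrite measure0|..|by []].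
split; last exact: measure_setY_lty.
by rewrite setY_def; apply: measurableU; exact: measurableD.
Qed.

(** The sets [W i] are prescribed only almost everywhere so that the lemma covers both the sets of
    odd count themselves and the sets [U i]+[V] coming from increments. *)
Lemma karlin_big_setY (B : I -> set E) (W : I -> set (point_measure E R))
    (J : {set I}) :
  (forall i, measurable (B i)) -> (forall i, (mu (B i) < +oo)%E) ->
  (forall i, measurable (W i)) ->
  (forall i, {ae mu_beta, forall m, (m \in W i) = (m \in odd_count (B i))}) ->
  mu_beta (\big[@setY _/set0]_(i in J) W i) =
  mu_beta (odd_count (\big[@setY E/set0]_(i in J) B i)).
Proof.
move=> mB fB mW WB; apply: ae_eq_measure.
- exact: measurable_big_setY.
- by apply: measurable_odd_count; exact: measurable_big_setY.
have ae1 : {ae mu_beta, forall m, forall i, (m \in W i) = (m \in odd_count (B i))}.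
  exact: filter_forall.
have ae2 : {ae mu_beta, forall m : point_measure E R, forall i, m (B i) <> +oo%E}.
  by apply: filter_forall => i; exact: karlin_count_finite.
apply: filterS2 ae1 ae2 => m mWB fm; rewrite in_big_setY.
under eq_bigr do rewrite mWB.
(* Measurability and finite count are carried through the induction because [odd_count_setY]
   requires them of both operands. *)
suff [_ _ ->] : [/\ measurable (\big[@setY E/set0]_(i in J) B i),
  m (\big[@setY E/set0]_(i in J) B i) <> +oo%E &
  (m \in odd_count (\big[@setY E/set0]_(i in J) B i)) =
    \big[addb/false]_(i in J) (m \in odd_count (B i))] by [].
elim/big_ind2: _ => [|b1 U b2 V [mU fU eU] [mV fV eV]|i _]; last by split.
- split; [by []|by rewrite measure0|].
  apply/negbTE; rewrite notin_setE => -[[|k]//= _]; rewrite measure0 => -[/eqP].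
  by rewrite eq_sym pnatr_eq0.
- split.
  + by rewrite setY_def; apply: measurableU; exact: measurableD.
  + by apply/eqP; rewrite -ltey measure_setY_lty// ltey; apply/eqP.
  + by rewrite odd_count_setY// eU eV.
Qed.

End karlin_measure.

(** The difference of indicators is the indicator of the symmetric difference times a sign that
    depends only on membership in [V], hence is common to all [i]. *)
Lemma norm_sum_indic_setY {T : Type} {R : realType} {I : finType} (c : I -> R)
    (U : I -> set T) (V : set T) x :
  `|\sum_i c i * (\1_(U i) x - \1_V x)| = `|\sum_i c i * \1_(U i `+` V) x|.
Proof.
have sgn i : \1_(U i) x - \1_V x = (-1) ^+ (x \in V) * \1_(U i `+` V) x :> R.
  rewrite !indicE setY_def in_setU !in_setD.
  by case: (x \in U i); case: (x \in V); rewrite /= ?expr1 ?expr0; ring.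
under eq_bigr do rewrite sgn mulrCA.
by rewrite -mulr_sumr normrM normr_sign mul1r.
Qed.

(** The image under g is the preimage under its inverse, and preimages commute with Boolean
    operations. *)
Lemma group_action_image_big_setY {G : groupType} {T : Type} (act : G -> T -> T)
    (hact : is_group_action act) g {I : finType} (B : I -> set T) (J : {set I}) :
  act g @` (\big[@setY T/set0]_(i in J) B i) =
  \big[@setY T/set0]_(i in J) (act g @` B i).
Proof.
have [h1 hM] := hact.
have imE C : act g @` C = act (g^-1)%g @^-1` C.
  apply/seteqP; split => [_ [x Cx <-]|x Cx] /=.
    by rewrite -hM mulVg h1.
  by exists (act (g^-1)%g x) => //; rewrite -hM mulgV h1.
rewrite imE; under [RHS]eq_bigr do rewrite imE.
by apply: (big_morph (fun C => act (g^-1)%g @^-1` C)).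
Qed.

Theorem theorem3p4 (R : realType) (alpha beta : R)
  (halpha : 0 < alpha <= 2) (hbeta : 0 < beta < 1)
  (X : metricType R) (o : X) (G : groupType)
  (actX : G -> X -> X) (hactX : is_group_action actX)
  (d : measure_display) (E : measurableType d)
  (mu : {sigma_finite_measure set E -> \bar R})
  (A : X -> set E) (mA : forall x, measurable (A x))
  (hdist : forall x y, (mdist x y)%:E = mu (A x `+` A y))
  (actE : G -> E -> E) (hactE : is_group_action actE)
  (mactE : forall g B, measurable B -> measurable (actE g @` B))
  (hactA : forall g x y,
     A (actX g x) `+` A (actX g y) = actE g @` (A x `+` A y) /\
     actE g @` (A x `+` A y) = (actE g @` A x) `+` (actE g @` A y))
  (hmu : forall g B, measurable B -> mu (actE g @` B) = mu B)
  (hAo : A o = set0)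
  (PP : R -> probability (point_measure E R) R)
  (hPP : forall (r : R) (hr : 0 < r),
     is_poisson_process_law (mscale (NngNum (ltW hr)) mu) (PP r))
  (mu_beta : {measure set (point_measure E R) -> \bar R})
  (hmu_beta : forall B, measurable B -> mu_beta B = karlin_measure beta PP B)
  (d' : measure_display) (Omega : measurableType d') (P : probability Omega R)
  (M : set (point_measure E R) -> {mfun Omega >-> R})
  (hM : is_sas_random_measure P alpha mu_beta M) :
  let eta := fun x : X => karlin_process M (A x) in
  is_sas_process P alpha eta /\
  forall g : G,
    fdd_eq P (fun x w => eta (actX g x) w - eta (actX g o) w)
             (fun x => eta x : Omega -> R).
Proof.
move=> eta; have [alpha0 _] := andP halpha.
have fA x : (mu (A x) < +oo)%E.
  (* Since [A o] is empty, the mass of [A x] is the distance from [x] to [o]. *)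
  by rewrite -[A x]setY0 -hAo -hdist ltry.
have mO x : measurable (odd_count (A x) : set (point_measure E R)).
  exact: measurable_odd_count.
have fO x : (mu_beta (odd_count (A x)) < +oo)%E.
  exact: (karlin_odd_count_lty hbeta hPP hmu_beta (mA x) (fA x)).
split.
  move=> n t c; eexists; last first.
    exact: (sas_lincomb alpha0 hM c (fun i => mO (t i)) (fun i => fO (t i))).
  exact: powR_ge0.
move=> g n t B mB.
pose U i := odd_count (A (actX g (t i))) : set (point_measure E R).
pose V := odd_count (A (actX g o)) : set (point_measure E R).
pose gA i := actE g @` A (t i).
have mgA i : measurable (gA i) by exact: mactE.
have fgA i : (mu (gA i) < +oo)%E by rewrite hmu.
have gAE i : gA i = A (actX g (t i)) `+` A (actX g o).
  by rewrite (hactA g (t i) o).1 hAo setY0.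
have mUV i : measurable (U i `+` V).
  by rewrite setY_def; apply: measurableU; apply: measurableD; exact: mO.
have aeUV i : {ae mu_beta, forall m, (m \in U i `+` V) = (m \in odd_count (gA i))}.
  have := karlin_count_finite hPP hmu_beta (mA (actX g o)) (fA _).
  apply: filterS2 (karlin_count_finite hPP hmu_beta (mA (actX g (t i))) (fA _)).
  move=> m mU mV; rewrite gAE odd_count_setY// setY_def in_setU !in_setD.
  by rewrite /U /V; case: (m \in _); case: (m \in _).
have intE (c : 'I_n -> R) :
    \int[mu_beta]_m `|\sum_i c i * (\1_(U i) m - \1_V m)| `^ alpha =
    \int[mu_beta]_m `|\sum_i c i * \1_(odd_count (A (t i))) m| `^ alpha.
  under eq_Rintegral do rewrite norm_sum_indic_setY.
  have e1 (J : {set 'I_n}) : mu_beta (\big[@setY _/set0]_(i in J) (U i `+` V)) =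
      mu_beta (odd_count (\big[@setY E/set0]_(i in J) gA i)).
    exact: (karlin_big_setY hPP hmu_beta J mgA fgA mUV aeUV).
  have e2 (J : {set 'I_n}) : mu_beta (\big[@setY _/set0]_(i in J) odd_count (A (t i))) =
      mu_beta (odd_count (\big[@setY E/set0]_(i in J) A (t i))).
    apply: (karlin_big_setY hPP hmu_beta J (fun i => mA (t i)) (fun i => fA (t i))
      (fun i => mO (t i))) => i.
    exact: aeW.
  apply: (eq_integral_powR_lincomb _ alpha0 mUV) => // J.
    rewrite e1; apply: (karlin_odd_count_lty hbeta hPP hmu_beta).
      exact: measurable_big_setY.
    exact: big_setY_lty.
  rewrite e1 e2; apply: (karlin_odd_count hPP hmu_beta).
  - exact: measurable_big_setY.
  - exact: measurable_big_setY.
  - exact: big_setY_lty.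
  - rewrite /gA -(group_action_image_big_setY hactE g (fun i => A (t i))).
    by apply: hmu; exact: measurable_big_setY.
(* A combination of increments is one of n + 1 values of [M]: index 0 carries the common set [V],
   with coefficient minus the sum of the [c i]. *)
pose B' (j : 'I_n.+1) := if unlift ord0 j is Some i then U i else V.
have mB' j : measurable (B' j) by rewrite /B'; case: unlift => [i|]; exact: mO.
have fB' j : (mu_beta (B' j) < +oo)%E by rewrite /B'; case: unlift => [i|]; exact: fO.
have law c :
    char_fun P (fun w =>
      \sum_(i < n) c i * (eta (actX g (t i)) w - eta (actX g o) w)) =1
    char_fun P (fun w => \sum_(i < n) c i * eta (t i) w).
  pose a (j : 'I_n.+1) := if unlift ord0 j is Some i then c i else - \sum_i c i.
  have sumE (f : set (point_measure E R) -> R) :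
      \sum_j a j * f (B' j) = \sum_(i < n) c i * (f (U i) - f V).
    rewrite big_ord_recl /a /B' unlift_none.
    rewrite [X in _ + X](eq_bigr (fun i => c i * f (U i))); last first.
      by move=> i _; rewrite liftK.
    under [RHS]eq_bigr do rewrite mulrBr.
    by rewrite sumrB -mulr_suml mulNr addrC.
  move=> theta.
  rewrite (sas_lincomb alpha0 hM c (fun i => mO (t i)) (fun i => fO (t i))) -intE.
  rewrite -[LHS]/(char_fun P (fun w => \sum_(i < n) c i * (M (U i) w - M V w)) theta).
  rewrite -(_ : (fun w => \sum_j a j * M (B' j) w) =
      (fun w => \sum_(i < n) c i * (M (U i) w - M V w))).
    rewrite (sas_lincomb alpha0 hM a mB' fB').
    under eq_Rintegral => m _ do rewrite (sumE (fun S => \1_S m)).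
    by [].
  by apply/funext => w; rewrite (sumE (fun S => M S w)).
have meta x : measurable_fun [set: Omega] (eta x) by [].
apply: (@characteristic_function_unique _ _ _ P n
  (fun w => [tuple eta (actX g (t i)) w - eta (actX g o) w | i < n])
  (fun w => [tuple eta (t i) w | i < n])) => //.
- apply/measurable_fun_tnthP => i.
  rewrite (_ : _ \o _ = fun w => eta (actX g (t i)) w - eta (actX g o) w).
    exact: measurable_funB.
  by apply/funext => w /=; rewrite tnth_mktuple.
- apply/measurable_fun_tnthP => i.
  rewrite (_ : _ \o _ = eta (t i)) //.
  by apply/funext => w /=; rewrite tnth_mktuple.
(* As [c] is arbitrary, the one-dimensional laws at theta = 1 give the whole joint characteristic
   function. *)
- move=> c; have /(congr1 (@complex.Re R)) /= := law c 1.
  under eq_Rintegral do rewrite mul1r.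
  under [RHS]eq_Rintegral do rewrite mul1r.
  move=> e; under eq_Rintegral => w _ do under eq_bigr do rewrite tnth_mktuple.
  rewrite e; apply: eq_Rintegral => w _; congr cos; apply: eq_bigr => i _.
  by rewrite tnth_mktuple.
- move=> c; have /(congr1 (@complex.Im R)) /= := law c 1.
  under eq_Rintegral do rewrite mul1r.
  under [RHS]eq_Rintegral do rewrite mul1r.
  move=> e; under eq_Rintegral => w _ do under eq_bigr do rewrite tnth_mktuple.
  rewrite e; apply: eq_Rintegral => w _; congr sin; apply: eq_bigr => i _.
  by rewrite tnth_mktuple.
Qed.
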